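(* Let $n\ge 0$, let $\mathbf m:[n]\to\mathbb Z_{\ge 0}$ be a reverse Hessenberg function, let $P=P_{\mathbf m}$ be the associated natural unit interval order, and let $\lambda\vdash n$. Then $\mathrm{HikSYT}(\mathbf m,\lambda)\subseteq \mathrm{strongST}_P(\lambda)$. Hence, if $c_\lambda^P>0$, then $\mathrm{strongST}_P(\lambda)\neq\emptyset$.
   Context: A reverse Hessenberg function is $\mathbf m:[n]\to\mathbb Z_{\ge0}$ with $\mathbf m(i)<i$ for all $i$ and $\mathbf m(i)\le \mathbf m(i+1)$. $P_{\mathbf m}$ is the poset on $[n]$ with $i<_{P_{\mathbf m}} j$ iff $i\le \mathbf m(j)$. For $k<n$, $\mathbf m^{(k)}$ is the restriction of $\mathbf m$ to $[k]$. Write $[m]_q=1+q+\dots+q^{m-1}$. Chromatic symmetric function: $\mathrm{inc}(P)$ is the graph on the elements of $P$ with edges between distinct incomparable elements; $X_G(\mathbf x)=\sum_\kappa\prod_{v}x_{\kappa(v)}$ over proper colorings $\kappa:V(G)\to\mathbb Z_{>0}$; $c_\lambda^P$ is the coefficient of the elementary symmetric function $e_\lambda(\mathbf x)$ in $X_{\mathrm{inc}(P)}(\mathbf x)$. Strong $P$-tableaux: Young diagrams are in English convention (cell $(i,j)$ in row $i$, column $j$); $\lambda'$ is the conjugate. A $P$-tableau of shape $\lambda$ is a filling $T:\lambda\to P$ with $T_{i,j}<_P T_{i+1,j}$ (columns) and $T_{i,j}\not>_P T_{i,j+1}$ (rows). For adjacent columns $C,D$ of a filling (each a chain), a ladder is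 a connected component of the subgraph of $\mathrm{inc}(P)$ induced on $C\cup D$; it is right-unbalanced if it has more elements in the right column $D$ than in the left column $C$. A $P$-tableau is strong if no pair of adjacent columns has a right-unbalanced ladder. $\mathrm{strongST}_P(\lambda)$ is the set of strong $P$-tableaux of shape $\lambda$ in which each element of $P$ appears exactly once. The entries $1,\dots,n$ of a standard Young tableau are viewed as elements of $P_{\mathbf m}$. Hikita tableaux: let $T$ be a standard Young tableau with $n$ cells, $0\le r\le n$, and let $t_i$ be the largest entry of column $i$ of $T$ ($t_i=0$ if the column is empty). Let $\delta^{(r)}(T)=(\delta_1,\dots,\delta_{n+1})$ with $\delta_i=1$ if $t_i>r$ and $\delta_i=0$ otherwise, and write it in blocks as $(1^{b_0},0^{a_1},1^{b_1},\dots,1^{b_\ell},0^{a_{\ell+1}})$ with $b_0\ge0$ and all other $a_i,b_i\ge 1$. For $0\le k\le \ell$ let $f_k^{(r)}(T)$ be the standard Young tableau obtained by adding $n+1$ at the bottom of column $1+\sum_{i=1}^k a_i+\sum_{i=0}^k b_i$ of $T$, and $$\varphi_k^{(r)}(T;q)=q^{\sum_{i=1}^k a_i}\prod_{i=1}^k\frac{\left[\sum_{j=i+1}^k a_j+\sum_{j=i}^k b_j\right]_q}{\left[\sum_{j=i}^k a_j+\sum_{j=i}^k b_j\right]_q}\prod_{i=k+1}^{\ell}\frac{\left[\sum_{j=k+1}^i a_j+\sum_{j=k+1}^{i-1} b_j\right]_q}{\left[\sum_{j=k+1}^i a_j+\sum_{j=k+1}^{i} b_j\right]_q}.$$ For $T$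 standard with $n$ cells define the rational function $\mathrm{prob}_{\mathbf m}(T;q)$ recursively: it is $1$ if $n=0$; it is $\varphi_k^{(r)}(S;q)\,\mathrm{prob}_{\mathbf m^{(n-1)}}(S;q)$ if $T=f_k^{(r)}(S)$ for some $k$ and standard $S$ with $n-1$ cells, where $r=\mathbf m(n)$; and it is $0$ otherwise. $\mathrm{HikSYT}(\mathbf m,\lambda)$ is the set of standard Young tableaux $T$ of shape $\lambda$ with $\mathrm{prob}_{\mathbf m}(T;q)\ne 0$. *)

(* Defs.v *)
From HB Require Import structures.
From mathcomp Require Import all_boot all_order all_algebra.
From mathcomp Require Import mpoly.
From Stdlib Require ClassicalEpsilon.

Set Implicit Arguments.
Unset Strict Implicit.
Unset Printing Implicit Defensive.

Import Order.TTheory GRing.Theory Num.Theory.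

(* Throughout, [n] = {1, ..., n} is 'I_n, the ordinal i standing for i.+1.    *)

(** * Reverse Hessenberg functions and natural unit interval orders *)

Record revHess (n : nat) := RevHess {
  rh_fun :> 'I_n -> nat;
  rh_lt : forall i : 'I_n, rh_fun i < i.+1;
  rh_mono : forall i j : 'I_n, j = i.+1 :> nat -> rh_fun i <= rh_fun j
}.

Lemma rh_restr_mono n (m : revHess n.+1) (i j : 'I_n) :
  j = i.+1 :> nat ->
  m (widen_ord (leqnSn n) i) <= m (widen_ord (leqnSn n) j).
Proof. by move=> ij; apply: rh_mono. Qed.

(* The restriction of m : [n.+1] -> nat to [n]. *)
Definition rh_restr n (m : revHess n.+1) : revHess n :=
  @RevHess n (fun i => m (widen_ord (leqnSn n) i))
    (fun i => rh_lt m (widen_ord (leqnSn n) i)) (@rh_restr_mono n m).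

(* The carrier of the poset P_m; it is a copy of 'I_n carrying m, so that it  *)
(* does not inherit the usual total order of 'I_n.                            *)
Definition nuio n (m : revHess n) : Type := 'I_n.

Definition nuio_label n (m : revHess n) (i : nuio m) : nat := (i : 'I_n).+1.

Fact nuio_display : Order.disp_t. Proof. exact: Order.Disp tt tt. Qed.

Section NuioOrder.
Variables (n : nat) (m : revHess n).

Definition nuio_lt : rel (nuio m) := fun i j => nuio_label i <= m j.

Lemma nuio_lt_ltn (i j : nuio m) : nuio_lt i j -> nuio_label i < nuio_label j.
Proof. by move=> ij; apply: leq_ltn_trans ij (rh_lt m j). Qed.

Lemma rh_monotone (i j : 'I_n) : i <= j -> m i <= m j.
Proof.
case: j => j; elim: j => [|j IH] jn /=.
  by rewrite leqn0 => /eqP i0; apply: eq_leq; congr (m _); apply: val_inj.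
rewrite leq_eqVlt => /predU1P [ij|ij].
  by apply: eq_leq; congr (m _); apply: val_inj.
exact: leq_trans (IH (ltnW jn) ij) (@rh_mono n m _ _ _).
Qed.

Lemma nuio_lt_irr : irreflexive nuio_lt.
Proof. by move=> i; apply/negP => /nuio_lt_ltn; rewrite ltnn. Qed.

Lemma nuio_lt_trans : transitive nuio_lt.
Proof.
move=> j i k ij jk; apply: leq_trans ij (rh_monotone _).
exact: ltnW (nuio_lt_ltn jk).
Qed.

HB.instance Definition _ := Finite.on (nuio m).
HB.instance Definition _ :=
  Order.Lt_isPOrder.Build nuio_display (nuio m) nuio_lt_irr nuio_lt_trans.

Lemma nuio_ltE (i j : nuio m) : (i < j)%O = (nuio_label i <= m j).
Proof. by []. Qed.

End NuioOrder.

(** * Partitions *)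

(* Partitions are the weakly decreasing sequences of positive integers. *)
Definition is_partn (n : nat) (lam : seq nat) : bool :=
  [&& sorted geq lam, all (leq 1) lam & sumn lam == n].

(** * Chromatic symmetric functions *)

Section Chromatic.
Local Open Scope ring_scope.
Variables (V : finType) (G : rel V).

Definition proper_coloring N (k : {ffun V -> 'I_N}) : bool :=
  [forall u, forall v, G u v ==> (k u != k v)].

(* A symmetric function in x_1, x_2, ... is given by the family of its        *)
(* specialisations x_{N+1} = x_{N+2} = ... = 0, for all N.                    *)
Definition chromatic N : {mpoly int[N]} :=
  \sum_(k : {ffun V -> 'I_N} | proper_coloring k) \prod_v 'X_(k v).

Definition elem_sym N (lam : seq nat) : {mpoly int[N]} :=
  \prod_(i <- lam) mesym N int i.

(* X_G = \sum_mu c_mu e_mu, the sum being over the partitions mu of #|V|;     *)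
(* these have at most #|V| parts, each at most #|V|.                          *)
Definition is_e_expansion (c : seq nat -> int) : Prop :=
  forall N, chromatic N =
    \sum_(mu : {bseq #|V| of 'I_#|V|.+1} | is_partn #|V| (map val mu))
       c (map val mu) *: elem_sym N (map val mu).

(* Since the e_mu form a basis of the ring of symmetric functions over Z, the *)
(* expansion exists and determines c on the partitions of #|V|.               *)
Definition e_coef : seq nat -> int :=
  ClassicalEpsilon.epsilon (inhabits (fun=> 0)) is_e_expansion.

End Chromatic.

Definition inc d (P : finPOrderType d) : rel P := fun x y => (x >< y)%O.

Definition chrom_coef d (P : finPOrderType d) (lam : seq nat) : int :=
  e_coef (@inc d P) lam.

(** * Tableaux *)

(* A filling of a Young diagram (English convention) is the sequence of its   *)
(* rows; its shape is the sequence of the lengths of the rows. Rows and       *)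
(* columns are numbered from 0.                                               *)
Definition column A (T : seq (seq A)) (j : nat) : seq A :=
  pmap (fun row => onth row j) T.

Section PTableaux.
Variables (d : Order.disp_t) (P : finPOrderType d).
Implicit Types (C D : seq P) (T : seq (seq P)) (lam : seq nat).

Definition is_Ptableau lam T : Prop :=
  [/\ shape T = lam,
      forall j, sorted (fun x y : P => (x < y)%O) (column T j)
    & forall row, row \in T -> sorted (fun x y : P => ~~ (y < x)%O) row].

Definition ladders C D : {set {set P}} :=
  let e := [rel x y | [&& x \in C ++ D, y \in C ++ D & inc x y]] in
  [set [set y | connect e x y] | x in C ++ D].

Definition right_unbalanced C D (L : {set P}) : bool :=
  #|[set x in L | x \in C]| < #|[set x in L | x \in D]|.

Definition is_strong T : Prop :=
  forall j L, L \in ladders (column T j) (column T j.+1) ->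
    ~~ right_unbalanced (column T j) (column T j.+1) L.

Definition strongST lam T : Prop :=
  [/\ is_Ptableau lam T, is_strong T
    & forall x : P, count_mem x (flatten T) = 1].

End PTableaux.

(* T has n cells, filled with 1, ..., n. *)
Definition is_SYT (n : nat) (T : seq (seq nat)) : bool :=
  [&& is_partn n (shape T), perm_eq (flatten T) (iota 1 n),
      all (sorted ltn) T & all (fun j => sorted ltn (column T j)) (iota 0 n)].

(** * Hikita tableaux *)

(* Run-length encoding: the i-th pair (b, a) stands for the block 1^b 0^a. *)
Fixpoint blocks (s : bitseq) : seq (nat * nat) :=
  match s with
  | [::] => [::]
  | true :: s' => if blocks s' is (b, a) :: B then (b.+1, a) :: B
                  else [:: (1, 0)]
  | false :: s' => if blocks s' is (0, a) :: B then (0, a.+1) :: B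
                   else (0, 1) :: blocks s'
  end.

Lemma blocksK (s : bitseq) :
  flatten [seq nseq ba.1 true ++ nseq ba.2 false | ba <- blocks s] = s.
Proof.
by elim: s => [|[] s /=] //=; case: (blocks s) => [|[[|b] a] B] //= ->.
Qed.

Lemma blocks_gt0 (s : bitseq) :
  all (fun ba => 0 < ba.1) (behead (blocks s)) &&
  all (fun ba => 0 < ba.2) (blocks (rcons s false)).
Proof.
apply/andP; split.
  by elim: s => [|[] s] //=; case: (blocks s) => [|[[|b] a] B].
suff: (0 < size (blocks (rcons s false))) &&
      all (fun ba => 0 < ba.2) (blocks (rcons s false)) by case/andP.
elim: s => [|[] s] //=;
  by case: (blocks (rcons s false)) => [|[[|b] a] B] //= /andP[].
Qed.

Local Open Scope ring_scope.

Notation Qq := {fraction {poly rat}}.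

Definition qvar : Qq := tofrac ('X : {poly rat}).

Definition qint (k : nat) : Qq := \sum_(0 <= i < k) qvar ^+ i.

Section HikitaStep.
Local Open Scope nat_scope.

Variables (n r : nat) (T : seq (seq nat)).

(* The entry at index i is \delta_{i+1}; an empty column has maximum 0. *)
Definition delta : bitseq :=
  mkseq (fun i => r < \max_(x <- column T i) x) n.+1.

(* delta = 1^(hb 0) 0^(ha 1) 1^(hb 1) ... 1^(hb hl) 0^(ha hl.+1) *)
Definition hl : nat := (size (blocks delta)).-1.
Definition hb (i : nat) : nat := (nth (0, 0) (blocks delta) i).1.
Definition ha (i : nat) : nat := (nth (0, 0) (blocks delta) i.-1).2.

(* Columns being numbered from 0, the leading 1 + is dropped. *)
Definition hcol (k : nat) : nat :=
  \sum_(1 <= i < k.+1) ha i + \sum_(0 <= i < k.+1) hb i.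

Definition add_bottom (j x : nat) : seq (seq nat) :=
  let i := size (column T j) in
  set_nth [::] T i (set_nth 0 (nth [::] T i) j x).

Definition hik_add (k : nat) : seq (seq nat) := add_bottom (hcol k) n.+1.

Definition hik_phi (k : nat) : Qq :=
  (qvar ^+ (\sum_(1 <= i < k.+1) ha i)%N
   * (\prod_(1 <= i < k.+1)
        (qint (\sum_(i.+1 <= j < k.+1) ha j + \sum_(i <= j < k.+1) hb j)%N
         / qint (\sum_(i <= j < k.+1) ha j + \sum_(i <= j < k.+1) hb j)%N))
   * (\prod_(k.+1 <= i < hl.+1)
        (qint (\sum_(k.+1 <= j < i.+1) ha j + \sum_(k.+1 <= j < i) hb j)%N
         / qint (\sum_(k.+1 <= j < i.+1) ha j
                 + \sum_(k.+1 <= j < i.+1) hb j)%N)))%R.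

End HikitaStep.

(* T without its entries greater than n. *)
Definition tab_restr (n : nat) (T : seq (seq nat)) : seq (seq nat) :=
  [seq row <- [seq [seq x <- row | (x <= n)%N] | row <- T] | row != [::]].

(* If T is f_k^(r)(S) for a standard S with n cells, then S is necessarily    *)
(* T without its entry n+1, and k is unique.                                  *)
Fixpoint prob n : revHess n -> seq (seq nat) -> Qq :=
  match n with
  | 0%N => fun _ _ => 1
  | n'.+1 => fun m T =>
      let r := m ord_max in
      let S := tab_restr n' T in
      if [pick k : 'I_(hl n' r S).+1 | is_SYT n' S && (hik_add n' r S k == T)]
        is Some k then hik_phi n' r S k * prob (rh_restr m) S
      else 0
  end.

Definition HikSYT n (m : revHess n) (lam : seq nat) (T : seq (seq nat)) : Prop :=
  [/\ is_SYT n T, shape T = lam & prob m T != 0].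

(* The tableau of integers underlying a filling by elements of P_m. *)
Definition tab_labels n (m : revHess n) (U : seq (seq (nuio m))) :
    seq (seq nat) :=
  [seq [seq nuio_label x | x <- row] | row <- U].

(* Main.v *)
Require Import Defs.
From mathcomp Require Import all_boot all_order all_fingroup all_algebra.
From mathcomp Require Import mpoly.
From mathcomp Require Import zify ring.
From Stdlib Require ClassicalEpsilon.

(** Strongness is a local property of the insertion process. When Hikita's
process puts the entry x at the foot of a column, the entries of that column
are at most r = m(x), and, unless the column is the first one, the column on
its left has an entry greater than r: the new cell always starts a block of
zeros of delta that follows a block of ones. Hence in a tableau of nonzero
probability the entries of a column form a chain of P, and every x outside the
first column has on its left some y < x with m(x) < y, that is, an entry
incomparable to x. Call such a tableau anchored. Given adjacent columns C and D
and a ladder, map each element x of D in the ladder to such a y in C. Then y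
lies in the ladder; and the map is injective, because y chosen for both x < x'
would give m(x') < y < x, making x and x' incomparable although they lie in one
column. So no ladder has more elements in D than in C ([anchored_strong],
[prob_anchored]).

The second assertion follows from Hikita's formula at q = 1. Record a tableau
by the word w whose i-th letter is the column, numbered from 0, of the i-th
entry. At q = 1, phi_k is the residue at c of
(1/z) prod_a (z - a)/(z - a - 1), where c is the column being extended and a
runs over the columns that have entries greater than r: within a block of ones
this product telescopes. The formula ([chromQ_word_sum]) says that X_inc(P) is
the sum over all words w of the product of these residues times
prod_r lam_r! e_(lam_r), where lam is the shape of w. Therefore a nonzero
coefficient c_lam provides a word of shape lam and nonzero weight; its letters
satisfy the two conditions above, and it spells an anchored tableau of shape
lam.

Both sides of the formula satisfy the modular law of Abreu and Nigro, at q = 1: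
the second difference is zero when one value of m is raised by 1 twice, or two
equal consecutive values are raised by 1 one after the other, provided that a
suitable pair of neighbouring vertices are twins. For colourings, exchange the colours of
the twins. For words, exchange their letters z and w: what remains of the
second difference is (w - z)/(w - z - 1) (g(z) g(w) + 1 - 2 g(z)) times a
symmetric factor, where g(z) = (z - j)/(z - j - 1), and the second factor equals
-(w - z - 1)/((z - j - 1)(w - j - 1)), so that the product is antisymmetric
([lower_defect_anti]; [upper_defect_anti] is the dual computation). A function
obeying the law and vanishing at the disjoint unions of cliques is zero
([modular_eq0]), and on such unions both sides are products of k! e_k.

The formula has rational coefficients. By the fundamental theorem of symmetric
polynomials in n variables, over the integers and over the rationals, they are
integers and are the coefficients c_lam ([chrom_coefE]).

Vertices and letters are numbered from 0: for m : nat -> nat, the neighbours of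
i before i are the j with m i <= j < i. *)

Set Implicit Arguments.
Unset Strict Implicit.
Unset Printing Implicit Defensive.

Import Order.TTheory GRing.Theory Num.Theory.
Local Open Scope nat_scope.

(** * Functions determined by the modular law *)
Section ModularUniqueness.
Variable n : nat.

Definition hessenberg (m : nat -> nat) : Prop :=
  (forall i, i < n -> m i <= i) /\ (forall i j, i <= j -> j < n -> m i <= m j).

Definition upd (m : nat -> nat) i x : nat -> nat := fun j => if j == i then x else m j.

(** In [law_upper] the vertices y and y.+1 are twins once i is set aside, and i
is joined to both, to y.+1 only, or to neither. In [law_lower] the twins are i
and i.+1, and y is joined to both, to i only, or to neither. *)
Record modular_law (f : (nat -> nat) -> rat) : Prop := ModularLaw {
  law_ext : forall m m', (forall i, i < n -> m i = m' i) -> f m = f m';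
  law_upper : forall m i y, i < n -> hessenberg (upd m i y) ->
    hessenberg (upd m i y.+2) -> m y = m y.+1 ->
    (f (upd m i y) + f (upd m i y.+2) = 2 * f (upd m i y.+1))%R;
  law_lower : forall m i y, i.+1 < n ->
    hessenberg (upd (upd m i y) i.+1 y) ->
    hessenberg (upd (upd m i y.+1) i.+1 y.+1) ->
    (forall k, k < n -> m k != i.+1) ->
    (f (upd (upd m i y) i.+1 y) + f (upd (upd m i y.+1) i.+1 y.+1)
     = 2 * f (upd (upd m i y) i.+1 y.+1))%R
}.

(** The law makes f affine along a segment of values. *)
Lemma affine_eq0 (F : nat -> rat) (a b : nat) :
  (forall x, a <= x -> x.+2 <= b -> (F x + F x.+2 = 2 * F x.+1)%R) ->
  F a = 0%R -> F b = 0%R -> forall x, a <= x <= b -> F x = 0%R.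
Proof.
move=> Faff Fa Fb x /andP[ax xb].
have Flin d : a + d.+1 <= b ->
    (F (a + d)%N = d%:R * F a.+1 /\ F (a + d).+1%N = d.+1%:R * F a.+1)%R.
  elim: d => [_|d IH db]; first by rewrite addn0 Fa mul0r mul1r.
  have [|Fd FSd] := IH; first by lia.
  rewrite addnS; split; first exact: FSd.
  have := Faff (a + d) (leq_addr _ _).
  rewrite Fd FSd => /(_ _)/(canRL (addKr _)) ->; last by lia.
  by rewrite -!natr1; ring.
have [->//|ltax] : x = a \/ a < x by lia.
have Fx y : a < y <= b -> (F y = (y - a)%:R * F a.+1)%R.
  move=> ayb; have [|_] := Flin (y - a).-1; first by lia.
  by rewrite -addnS prednK ?subnKC //; lia.
have F1 : F a.+1 = 0%R.
  have /eqP := Fx b ltac:(lia); rewrite Fb eq_sym mulf_eq0 pnatr_eq0.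
  by case/orP => [|/eqP//]; lia.
by rewrite Fx ?F1 ?mulr0 //; lia.
Qed.

Variable f : (nat -> nat) -> rat.
Hypothesis fmod : modular_law f.

(** A run is a maximal interval [k, k + l) on which m is constant, here with
value v; its vertices are twins for the vertices above. By the lower law, f is
affine in j when the last j values of the run are raised to v.+1. For j = l the value at k
exceeds v. For j = l.-1 only the value at k is left to raise, and by the upper
law f is affine in that value between s and v.+1, because its neighbours there
are twins inside the block [s, s + p). Both ends of that segment are zeros of f,
so f vanishes at j = l and at j = l.-1, hence at j = 0. *)
Lemma modular_run_eq0 s p m k v l :
  hessenberg m -> (forall i, s <= i < s + p -> m i = m s) ->
  s < v < s + p -> s + p <= k -> 0 < l -> k + l <= n ->
  (forall i, i < k -> m i <= s) ->
  (forall i, k <= i < k + l -> m i = v) ->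
  (forall i, k + l <= i < n -> v < m i) ->
  (forall i, i < n -> ~~ (k < m i < k + l)) ->
  (forall m', hessenberg m' -> (forall i, i < k -> m' i = m i) ->
     m' k = s \/ v < m' k -> f m' = 0%R) ->
  f m = 0%R.
Proof.
move=> [mlt mmono] mblk sv spk l_gt0 kln mlow mrun mhigh mtwin IH.
(* M j raises the last j values of the run. *)
pose M j i := if (k + l - j <= i) && (i < k + l) then v.+1 else m i.
have Mhess j : j <= l -> hessenberg (M j).
  move=> jl; split=> [i|i i'] ilt; rewrite /M.
    by case: ifP => [|_]; [lia | exact: mlt].
  move=> i'n; have := mmono i i' ilt i'n.
  case: ifP => ci; case: ifP => ci'; try lia.
    by have := mhigh i'; lia.
  have [ik|ki] := ltnP i k; first by have := mlow i ik; lia.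
  by have := mrun i; lia.
have M0 : f m = f (M 0).
  apply: (law_ext fmod) => i _; rewrite /M; case: ifP => //; lia.
have Mlo j i : j <= l -> i < k -> M j i = m i by rewrite /M; case: ifP => //; lia.
(* Q x moreover gives the value x to the first vertex of the run. *)
pose Q x := upd (M l.-1) k x.
have Qhess x : s <= x <= v.+1 -> hessenberg (Q x).
  have [Mlt Mmono] := Mhess l.-1 ltac:(lia).
  move=> xb; split=> [i|i i'] ilt; rewrite /Q /upd.
    by case: eqP => [->|_]; [lia | exact: Mlt].
  move=> i'n; have := Mmono i i' ilt i'n.
  case: eqP => [ik|ik]; case: eqP => [ki'|ki'] //; last first.
    by rewrite ki' (Mlo _ i) ?mlow //; [have := mlow i; lia | lia | lia].
  move=> _; rewrite /M; case: ifP => ci; first lia.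
  by have := mhigh i'; lia.
have FQ x : s <= x <= v.+1 -> f (Q x) = 0%R.
  apply: (@affine_eq0 (fun x => f (Q x))) => {x}.
  - move=> x sx xv; apply: (law_upper fmod); first lia.
    + by apply: Qhess; lia.
    + by apply: Qhess; lia.
    + by rewrite !Mlo ?mblk //; try lia; rewrite (mblk x.+1) //; lia.
  - apply: IH; [apply: Qhess; lia | | by left; rewrite /Q /upd eqxx].
    by move=> i ik; rewrite /Q /upd ltn_eqF // Mlo //; lia.
  - apply: IH; [apply: Qhess; lia | | by right; rewrite /Q /upd eqxx].
    by move=> i ik; rewrite /Q /upd ltn_eqF // Mlo //; lia.
have Fl : f (M l) = 0%R.
  apply: IH; [exact: Mhess | by move=> i; exact: Mlo | right].
  by rewrite /M; case: ifP => //; lia.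
have Fl1 : f (M l.-1) = 0%R.
  rewrite -(FQ v); last by lia.
  apply: (law_ext fmod) => i _; rewrite /Q /upd; case: eqP => // ->.
  by rewrite /M; case: ifP => [|_]; [lia | apply: mrun; lia].
have Fstep j : j.+2 <= l -> (f (M j) + f (M j.+2) = 2 * f (M j.+1))%R.
  move=> jl; set i := k + l - j.+2.
  pose u a b := upd (upd (M j) i a) i.+1 b.
  have e0 t : t < n -> M j t = u v v t.
    move=> _; rewrite /u /upd; case: eqP => [->|ti1].
      by rewrite /M; case: ifP => [|_]; [lia | apply: mrun; lia].
    case: eqP => // ->.
    by rewrite /M; case: ifP => [|_]; [lia | apply: mrun; lia].
  have e1 t : t < n -> M j.+1 t = u v v.+1 t.
    move=> _; rewrite /u /upd; case: eqP => [->|ti1].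
      by rewrite /M; case: ifP => //; lia.
    case: eqP => [->|ti].
      by rewrite /M; case: ifP => [|_]; [lia | apply: mrun; lia].
    by rewrite /M; do 2!case: ifP => //; lia.
  have e2 t : t < n -> M j.+2 t = u v.+1 v.+1 t.
    move=> _; rewrite /u /upd; case: eqP => [->|ti1].
      by rewrite /M; case: ifP => //; lia.
    case: eqP => [->|ti].
      by rewrite /M; case: ifP => //; lia.
    by rewrite /M; do 2!case: ifP => //; lia.
  have hext m1 m2 : (forall t, t < n -> m1 t = m2 t) -> hessenberg m1 -> hessenberg m2.
    move=> e [h1 h2]; split=> [t tn|t t' tt' t'n]; first by rewrite -e // h1.
    by rewrite -!e ?h2 //; exact: leq_ltn_trans t'n.
  rewrite (law_ext fmod e0) (law_ext fmod e1) (law_ext fmod e2).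
  apply: (law_lower fmod).
  - by lia.
  - by apply: hext e0 _; apply: Mhess; lia.
  - by apply: hext e2 _; apply: Mhess; lia.
  - move=> t tn; rewrite /M; case: ifP => [_|_]; first by lia.
    by have := mtwin t tn; lia.
rewrite M0.
have Fdown j : j < l -> f (M (l - j)) = 0%R /\ f (M (l - j.+1)) = 0%R.
  elim: j => [|j IHj] jl; first by rewrite subn0 subn1.
  have [Fj Fj1] := IHj (ltnW jl); split=> //.
  have := Fstep (l - j.+2); rewrite -!subSn ?subSS //; try lia.
  rewrite Fj Fj1 mulr0 addr0; apply; lia.
by have [|_] := Fdown l.-1; [lia | rewrite prednK // subnn].
Qed.

(** If m is constant on [s, s + p), it is enough to know f at those m' that agree
with m up to the end of the block and never separate two vertices of it. The
bad indices, whose value lies strictly inside the block, are removed in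
increasing order. To treat the first bad index k, the lemma is needed for the
run that starts at k, a block further right: whence the induction on n - s. *)
Lemma modular_block_eq0 s p m :
  hessenberg m -> 0 < p -> s + p <= n -> (forall i, s <= i < s + p -> m i = m s) ->
  (forall m', hessenberg m' -> (forall i, i < s + p -> m' i = m i) ->
     (forall k, k < n -> ~~ (s < m' k < s + p)) -> f m' = 0%R) ->
  f m = 0%R.
Proof.
move: {2}(n - s) (leqnn (n - s)) => d.
elim: d s p m => [|d IHd] s p m0 ds hm0 p_gt0 spn mblk0 IH0; first lia.
(* Induction on n - k, where no index before k is bad. *)
have Hk e : forall k m, n - k <= e -> s + p <= k -> hessenberg m ->
    (forall i, i < s + p -> m i = m0 i) ->
    (forall i, i < k -> i < n -> ~~ (s < m i < s + p)) -> f m = 0%R.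
  elim: e => [|e IHe] k m ke spk hm mm0 mk.
    by apply: IH0 => // i ilt; apply: mk => //; lia.
  have [nk|kn] := leqP n k.
    by apply: IH0 => // i ilt; apply: mk => //; lia.
  have mlow m' : hessenberg m' -> (forall i, i < k -> m' i = m i) ->
      m' k < s + p -> forall i, i < k -> m' i <= s.
    move=> hm' m'm m'k i ik; have := mk i ik (ltn_trans ik kn).
    by have := hm'.2 i k (ltnW ik) kn; rewrite m'm //; lia.
  have settled m' : hessenberg m' -> (forall i, i < k -> m' i = m i) ->
      ~~ (s < m' k < s + p) -> f m' = 0%R.
    move=> hm' m'm m'k; apply: (IHe k.+1) => //; first lia; first lia.
      by move=> i ilt; rewrite m'm ?mm0 //; lia.
    move=> i; rewrite ltnS leq_eqVlt => /orP[/eqP->//|ik] ilt.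
    by rewrite m'm ?mk.
  (* The value at k is treated downwards from s + p. *)
  have Hv e' : forall v m', s + p - v <= e' -> s < v -> hessenberg m' ->
      (forall i, i < k -> m' i = m i) -> v <= m' k -> f m' = 0%R.
    elim: e' => [|e' IHv] v m1 ve sv hm1 m1m vm1; first by apply: settled => //; lia.
    have [m1v|m1v] := ltnP v (m1 k); first by apply: (IHv v.+1) => //; lia.
    have {vm1 m1v} m1k : m1 k = v by lia.
    have [vsp|vsp] := leqP (s + p) v; first by apply: settled => //; lia.
    (* Runs of v's starting at k are treated by decreasing length, since the
       recursive call changes the values after the run and may lengthen it. *)
    have Hl e'' : forall l m', n - (k + l) < e'' -> 0 < l -> k + l <= n ->
        hessenberg m' -> (forall i, i < k -> m' i = m i) ->
        (forall i, k <= i < k + l -> m' i = v) -> f m' = 0%R.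
      elim: e'' => [|e'' IHl] l m2 le l_gt0 kln hm2 m2m m2run; first lia.
      apply: (IHd k l m2) => //; try lia.
        by move=> i ilt; rewrite !m2run //; lia.
      move=> m3 hm3 m3m m3tw.
      have m3m' i : i < k -> m3 i = m i by move=> ik; rewrite m3m ?m2m //; lia.
      have m3run i : k <= i < k + l -> m3 i = v.
        by move=> ilt; rewrite m3m ?m2run //; lia.
      have [/andP[klt /eqP m3kl]|Hkl] :=
        boolP ((k + l < n) && (m3 (k + l) == v)).
        apply: (IHl l.+1 m3) => //; try lia.
        move=> i ilt; have [->//|ikl] : i = k + l \/ i < k + l by lia.
        by apply: m3run; lia.
      apply: (@modular_run_eq0 s p m3 k v l) => //; try lia.
      - move=> i ilt; rewrite !m3m' ?mm0 ?mblk0 //; lia.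
      - by apply: mlow => //; rewrite m3run //; lia.
      - move=> i ilt; have := hm3.2 (k + l) i; have := hm3.2 k (k + l).
        rewrite (m3run k); lia.
      - move=> m4 hm4 m4m [m4s|m4v].
          apply: settled => //; first by move=> i ik; rewrite m4m ?m3m' //; lia.
          by rewrite m4s ltnn.
        by apply: (IHv v.+1) => //; [lia | lia | move=> i ik; rewrite m4m ?m3m' //; lia].
    apply: (Hl n.+1 1 m1) => //; try lia.
    by move=> i ilt; rewrite (_ : i = k) //; lia.
  have [mks|smk] := leqP (m k) s; first by apply: settled => //; lia.
  by apply: (Hv (s + p) (m k)) => //; lia.
apply: (Hk n (s + p) m0) => // [|i ilt iln]; first lia.
have [si|si] := ltnP i s.
  by have := hm0.1 i iln; lia.
rewrite mblk0; last by lia.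
by have := hm0.1 s; lia.
Qed.

Definition clique_union (m : nat -> nat) : Prop :=
  forall i, i < n -> m i = i \/ (0 < i /\ m i = m i.-1).

(** Scan the blocks from the left: after [modular_block_eq0], either the first
block that is not yet known to be a component grows, or it is a component. *)
Theorem modular_eq0 :
  (forall m, hessenberg m -> clique_union m -> f m = 0%R) ->
  forall m, hessenberg m -> f m = 0%R.
Proof.
move=> fblock.
have H d : forall s m, n - s <= d -> hessenberg m ->
    (forall i, i < s -> i < n -> m i = i \/ (0 < i /\ m i = m i.-1)) ->
    (forall i, s <= i < n -> s <= m i) -> f m = 0%R.
  elim: d => [|d IHd] s m ds hm mlo mhi.
    by apply: fblock => // i ilt; apply: mlo => //; lia.
  have [ns|sn] := leqP n s; first by apply: fblock => // i ilt; apply: mlo => //; lia.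
  have Ha e : forall a m', s + a <= n -> n - (s + a) < e -> 0 < a -> hessenberg m' ->
      (forall i, i < s -> m' i = m i) ->
      (forall i, s <= i < s + a -> m' i = s) -> f m' = 0%R.
    elim: e => [|e IHe] a m1 san ae a_gt0 hm1 m1m m1blk; first lia.
    apply: (@modular_block_eq0 s a m1) => // [i ilt|m2 hm2 m2m m2settled].
      by rewrite !m1blk //; lia.
    have mlo2 i : i < s + a -> i < n -> m2 i = i \/ (0 < i /\ m2 i = m2 i.-1).
      move=> isa ilt; have [is_|si] := ltnP i s.
        by have := mlo i is_ ilt; rewrite !m2m ?m1m //; lia.
      have [->|si'] : i = s \/ s < i by lia.
        by left; rewrite m2m ?m1blk; lia.
      by right; rewrite !m2m ?(m1blk i) ?(m1blk i.-1); lia.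
    have [san'|san'] := leqP n (s + a).
      by apply: fblock => // i ilt; apply: mlo2 => //; lia.
    have m2s : m2 s = s by rewrite m2m ?m1blk; lia.
    have := hm2.2 s (s + a) (leq_addr _ _) san'.
    rewrite m2s leq_eqVlt => /orP[/eqP m2sa|m2sa].
      apply: (IHe a.+1 m2) => //; try lia.
        by move=> i ilt; rewrite m2m ?m1m //; lia.
      move=> i ilt; have [->//|ilt'] : i = s + a \/ i < s + a by lia.
      by rewrite m2m ?m1blk //; lia.
    apply: (IHd (s + a) m2) => //; first lia.
    move=> i ilt; have := hm2.2 (s + a) i; have := m2settled (s + a) san'; lia.
  have ms : m s = s by have := hm.1 s sn; have := mhi s; lia.
  by apply: (Ha n.+1 1 m) => //; [lia | lia | move=> i ilt; have -> : i = s by lia].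
by move=> m hm; apply: (H n 0 m) => //; lia.
Qed.

End ModularUniqueness.

(** * The modular law for chromatic symmetric functions *)

Section Swap.
Variables (n : nat) (T : finType).
Implicit Types k : {ffun 'I_n -> T}.

Definition swap (a b : 'I_n) k : {ffun 'I_n -> T} := [ffun i => k (tperm a b i)].

Lemma swapK a b : involutive (swap a b).
Proof. by move=> k; apply/ffunP=> i; rewrite !ffunE tpermK. Qed.

Lemma sum_swap_anti (V : lmodType rat) a b (D : {ffun 'I_n -> T} -> V) :
  (forall k, D (swap a b k) = - D k)%R -> (\sum_k D k = 0)%R.
Proof.
move=> Danti; set s := (\sum_k _)%R.
have : (s = - s)%R.
  rewrite {1}/s (reindex_inj (inv_inj (swapK a b))) /=.
  by rewrite (eq_bigr _ (fun k _ => Danti k)) sumrN.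
move/eqP; rewrite -addr_eq0 -mulr2n -scaler_nat scaler_eq0 pnatr_eq0 /=.
by move/eqP.
Qed.
End Swap.

Definition adjacent (m : nat -> nat) (u v : nat) : bool :=
  (m v <= u < v) || (m u <= v < u).

Lemma adjacentC m u v : adjacent m u v = adjacent m v u.
Proof. by rewrite /adjacent orbC. Qed.

Lemma adjacent_swap n m (a : nat) (i j u v : 'I_n) :
  i = a :> nat -> j = a.+1 :> nat -> m a = m a.+1 ->
  (forall k, k < n -> m k != a.+1) ->
  adjacent m (tperm i j u) (tperm i j v) = adjacent m u v.
Proof.
move=> ia ja mE mN; have := mN u (ltn_ord u); have := mN v (ltn_ord v).
have neq (x y : 'I_n) : x <> y -> (x : nat) <> y by move=> xy /val_inj.
rewrite /adjacent; case: tpermP => [->|->|/neq + /neq +];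
  case: tpermP => [->|->|/neq + /neq +]; rewrite ?ia ?ja -?mE; lia.
Qed.

(** Monotonicity on both sides of i leaves no other vertex with value y.+1, which
is why y and y.+1 are twins once i is set aside. *)
Lemma hessenberg_upd_between n m i y : i < n -> hessenberg n (upd m i y) ->
  hessenberg n (upd m i y.+2) ->
  [/\ y.+1 < i, forall k, k < n -> k != i -> m k != y.+1
    & forall k, k < n -> k < i -> m k <= y].
Proof.
move=> ilt [h0 h0'] [h2 h2'].
have yi : y.+1 < i by have := h2 i ilt; rewrite /upd eqxx.
have lo k : k < n -> k < i -> m k <= y.
  move=> kn ki; have := h0' k i (ltnW ki) ilt.
  by rewrite /upd eqxx; case: eqP => //; lia.
have hi k : k < n -> i < k -> y.+2 <= m k.
  move=> kn ki; have := h2' i k (ltnW ki) kn.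
  by rewrite /upd eqxx; case: eqP => //; lia.
split=> // k kn ki; have [ik|ik] : k < i \/ i < k by lia.
  by have := lo k kn ik; lia.
by have := hi k kn ik; lia.
Qed.

Section Coloring.
Variables (n N : nat).
Implicit Types (m : nat -> nat) (k : {ffun 'I_n -> 'I_N}).

Definition is_proper m k : bool :=
  [forall u : 'I_n, forall v : 'I_n, adjacent m u v ==> (k u != k v)].

(** The chromatic symmetric function in N variables of the graph of m. *)
Definition chromQ m : {mpoly rat[N]} :=
  (\sum_(k : {ffun 'I_n -> 'I_N} | is_proper m k) \prod_i 'X_(k i))%R.

Lemma proper_swap m (i j : 'I_n) k :
  (forall u v : 'I_n, adjacent m (tperm i j u) (tperm i j v) = adjacent m u v) ->
  is_proper m (swap i j k) = is_proper m k.
Proof.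
move=> madj; apply/forallP/forallP=> H u; apply/forallP=> v; apply/implyP.
  have /forallP/(_ (tperm i j v))/implyP := H (tperm i j u).
  by rewrite madj !ffunE !tpermK.
move=> uv; have /forallP/(_ (tperm i j v))/implyP := H (tperm i j u).
by rewrite madj !ffunE => /(_ uv).
Qed.

Lemma proper_edge m m' (a c : 'I_n) k :
  (forall u v : 'I_n, adjacent m u v =
     [|| adjacent m' u v, (u == a) && (v == c) | (u == c) && (v == a)]) ->
  is_proper m k = is_proper m' k && (k a != k c).
Proof.
move=> madj; apply/idP/andP=> [/forallP H|[/forallP H ac]].
  split; last first.
    by have /forallP/(_ c)/implyP := H a; apply; rewrite madj !eqxx orbT.
  apply/forallP=> u; apply/forallP=> v; apply/implyP=> uv.
  by have /forallP/(_ v)/implyP := H u; apply; rewrite madj uv.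
apply/forallP=> u; apply/forallP=> v; apply/implyP; rewrite madj.
case/or3P => [uv|/andP[/eqP-> /eqP->] //|/andP[/eqP-> /eqP->]].
  by have /forallP/(_ v)/implyP := H u; apply.
by rewrite eq_sym.
Qed.

(** The three graphs have the same edges except ac and bc, where a and b are
adjacent twins. A colouring that is proper for m2 contributes pq + 1 - 2p, with
p, q telling whether c differs in colour from a, b. Exchanging the colours of a
and b exchanges p and q, and the two contributions add up to 2(1 - p)(1 - q),
which is 0 because a and b have different colours. *)
Lemma chromQ_twin m0 m1 m2 (a b c : 'I_n) :
  a != b -> c != a -> c != b -> adjacent m2 a b ->
  (forall u v : 'I_n, adjacent m2 (tperm a b u) (tperm a b v) = adjacent m2 u v) ->
  (forall u v : 'I_n, adjacent m1 u v =
     [|| adjacent m2 u v, (u == a) && (v == c) | (u == c) && (v == a)]) ->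
  (forall u v : 'I_n, adjacent m0 u v =
     [|| adjacent m1 u v, (u == b) && (v == c) | (u == c) && (v == b)]) ->
  (chromQ m0 + chromQ m2 = 2 * chromQ m1)%R.
Proof.
move=> ab ca cb adj_ab madj e1 e0; apply/eqP; rewrite -subr_eq0; apply/eqP.
rewrite /chromQ !(big_mkcond (is_proper _)) /= mulr_sumr -big_split -sumrB /=.
apply: (@sum_swap_anti n 'I_N {mpoly rat[N]} a b) => k.
set F := (\prod_i 'X_(k i))%R.
have -> : (\prod_i 'X_(swap a b k i) = F :> {mpoly rat[N]})%R.
  rewrite /F (reindex_inj (@perm_inj _ (tperm a b))) /=.
  by apply: eq_bigr => i _; rewrite ffunE tpermK.
rewrite !(proper_edge _ e0) !(proper_edge _ e1) proper_swap // !ffunE.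
rewrite tpermL tpermR tpermD; [|by rewrite eq_sym|by rewrite eq_sym].
case P2: (is_proper m2 k) => /=; last by rewrite mulr0 !addr0 subr0 oppr0.
have kab : k a != k b.
  by move/forallP: P2 => /(_ a)/forallP/(_ b)/implyP; apply.
have [kac|kac] := eqVneq (k a) (k c); have [kbc|kbc] := eqVneq (k b) (k c) => /=.
- by rewrite kac kbc eqxx in kab.
- by ring.
- by ring.
- by ring.
Qed.

Lemma chromQ_upper m i y : i < n -> hessenberg n (upd m i y) ->
  hessenberg n (upd m i y.+2) -> m y = m y.+1 ->
  (chromQ (upd m i y) + chromQ (upd m i y.+2) = 2 * chromQ (upd m i y.+1))%R.
Proof.
move=> ilt h0 h2 mE; have [yi mN mlo] := hessenberg_upd_between ilt h0 h2.
have [y1n yn] : y.+1 < n /\ y < n by lia.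
pose a := Ordinal y1n; pose b := Ordinal yn; pose c := Ordinal ilt.
have vE (u v : 'I_n) : (u == v) = (u == v :> nat) by [].
apply: (@chromQ_twin _ _ _ a b c).
- by rewrite vE /=; lia.
- by rewrite vE /=; lia.
- by rewrite vE /=; lia.
- rewrite adjacentC /adjacent /upd /= ltn_eqF // -mE.
  by have := mlo y yn; have := h0.1 y yn; rewrite /upd ltn_eqF; lia.
- move=> u v; rewrite tpermC; apply: (adjacent_swap (a := y)) => //.
    by rewrite /upd !ltn_eqF //; lia.
  by move=> k kn; rewrite /upd; have [_|ki] := eqVneq k i; [lia | exact: mN].
- move=> u v; rewrite !vE /adjacent /upd /=.
  by case: eqP; case: eqP; lia.
- move=> u v; rewrite !vE /adjacent /upd /=.
  by case: eqP; case: eqP; lia.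
Qed.

Lemma chromQ_lower m i y : i.+1 < n ->
  hessenberg n (upd (upd m i y) i.+1 y) ->
  hessenberg n (upd (upd m i y.+1) i.+1 y.+1) ->
  (forall t, t < n -> m t != i.+1) ->
  (chromQ (upd (upd m i y) i.+1 y) + chromQ (upd (upd m i y.+1) i.+1 y.+1)
     = 2 * chromQ (upd (upd m i y) i.+1 y.+1))%R.
Proof.
move=> i1n h0 h2 mN.
have iN : i < n by lia.
have yi : y < i by have := h2.1 i iN; rewrite /upd ltn_eqF ?eqxx.
have yn : y < n by lia.
pose a := Ordinal iN; pose b := Ordinal i1n; pose c := Ordinal yn.
have vE (u v : 'I_n) : (u == v) = (u == v :> nat) by [].
have uE : upd (upd m i y.+1) i.+1 y.+1 i.+1 = y.+1 by rewrite /upd eqxx.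
apply: (@chromQ_twin _ _ _ a b c).
- by rewrite vE /=; lia.
- by rewrite vE /=; lia.
- by rewrite vE /=; lia.
- by rewrite /adjacent /= uE; lia.
- move=> u v; apply: (adjacent_swap (a := i)) => //.
    by rewrite /upd !eqxx ltn_eqF //; lia.
  move=> k kn; rewrite /upd; have [_|_] := eqVneq k i.+1; first by lia.
  by have [_|_] := eqVneq k i; [lia | exact: mN].
- move=> u v; rewrite !vE /adjacent /upd /=.
  by do 4!case: eqP; lia.
- move=> u v; rewrite !vE /adjacent /upd /=.
  by do 4!case: eqP; lia.
Qed.
End Coloring.

(** * Weights of words, and their modular law *)

(** The factor (z - a)/(z - a - 1) at z = c, or its residue if c is the pole. *)
Definition nbr_factor (a c : nat) : rat :=
  if a.+1 == c then 1%R else ((c%:R - a%:R) / (c%:R - a%:R - 1))%R.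

Lemma nbr_factor_id c : nbr_factor c c = 0%R.
Proof. by rewrite /nbr_factor ifN ?subrr ?mul0r //; lia. Qed.

Lemma nbr_factorS a : nbr_factor a a.+1 = 1%R.
Proof. by rewrite /nbr_factor eqxx. Qed.

Lemma nbr_factor_neqS a c : a.+1 <> c ->
  nbr_factor a c = ((c%:R - a%:R) / (c%:R - a%:R - 1))%R.
Proof. by rewrite /nbr_factor; case: eqP. Qed.

Section ResidueIdentities.
Local Open Scope ring_scope.

Lemma natr_subS_neq0 (a c : nat) : a.+1 <> c -> (c%:R - a%:R - 1 != 0 :> rat).
Proof.
by move=> ac; rewrite -addrA -opprD natr1 subr_eq0 eqr_nat eq_sym; apply/eqP.
Qed.

Lemma natr_sub_neq0 (a c : nat) : a <> c -> (c%:R - a%:R != 0 :> rat).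
Proof. by move=> ac; rewrite subr_eq0 eqr_nat eq_sym; apply/eqP. Qed.

Lemma nbr_factorSS a : nbr_factor a a.+2 = 2.
Proof.
rewrite nbr_factor_neqS; last by lia.
have -> : a.+2%:R - a%:R = 2 :> rat by rewrite -!natr1; ring.
by [].
Qed.

Lemma nbr_factor_pred a : nbr_factor a.+1 a = 2^-1.
Proof.
rewrite nbr_factor_neqS; last by lia.
by rewrite -natr1 opprD addrA subrr add0r -opprD invrN mulrNN mul1r.
Qed.

(** With S the window common to the twins i and i.+1, whose letters are c and d,
and j the letter of the vertex y, this is the second difference of the weights
of the twins after division by the factors coming from S; al and be tell whether
c and d are poles of the product over S. *)
Definition lower_defect (al be : bool) (j c d : nat) : rat :=
  ((al || (j.+1 == c))%:R * nbr_factor j c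
     * (be || (j.+1 == d) || (c.+1 == d))%:R * nbr_factor j d
   + al%:R * (be || (c.+1 == d))%:R
   - 2 * ((al || (j.+1 == c))%:R * nbr_factor j c * (be || (c.+1 == d))%:R))
  * nbr_factor c d.

(** Away from coincidences this is the identity
g(c) g(d) + 1 - 2 g(c) = - (d - c - 1)/((c - j - 1)(d - j - 1)). The hypotheses
hold because the letters in S differ from j, c and d; they matter where a letter
is the successor of another one and a factor becomes a residue. *)
Lemma lower_defect_anti (al be : bool) (j c d : nat) :
  (j.+1 = c -> ~~ al) -> (j.+1 = d -> ~~ be) ->
  (c.+1 = d -> ~~ be) -> (d.+1 = c -> ~~ al) ->
  lower_defect al be j c d + lower_defect be al j d c = 0.
Proof.
have neF (a b : nat) : a <> b -> (a == b) = false by move/eqP/negbTE.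
pose A (al be : bool) (c d : nat) :=
  lower_defect al be j c d + lower_defect be al j d c.
have AC al' be' c' d' : A al' be' c' d' = A be' al' d' c' by exact: addrC.
rewrite -/(A al be c d) => hc hd hcd hdc.
have [cd|/eqP cd] := eqVneq c d.
  by rewrite /A /lower_defect cd !nbr_factor_id !mulr0 addr0.
have J (be' : bool) (d' : nat) : j.+1 <> d' -> (j.+2 = d' -> ~~ be') ->
    A false be' j.+1 d' = 0.
  move=> jd hbe; rewrite /A /lower_defect eqxx (neF _ _ jd) nbr_factorS /= !orbF.
  have [djS|/eqP djS] := eqVneq j.+2 d'.
    rewrite (negPf (hbe djS)) {be' hbe}; subst d'.
    rewrite (neF j.+3 j.+1) ?nbr_factorS ?nbr_factorSS; last lia.
    by rewrite ?orbT /=; ring.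
  have [dj|/eqP dj] := eqVneq d'.+1 j.+1.
    have {jd dj djS hbe}-> : d' = j by lia.
    rewrite nbr_factorS nbr_factor_id nbr_factor_pred !orbF.
    by case: be' => /=; field.
  rewrite !nbr_factor_neqS // !orbF.
  have := natr_subS_neq0 jd; have := natr_subS_neq0 djS; have := natr_subS_neq0 dj.
  rewrite -!natr1 => h1 h2 h3.
  by case: be' {hbe} => /=; field; rewrite ?h1 ?h2 ?h3.
have K (al' : bool) (c' : nat) : j.+1 <> c' -> j.+1 <> c'.+1 ->
    A al' false c' c'.+1 = 0.
  move=> jc jc1; rewrite /A /lower_defect eqxx !(neF j.+1) // nbr_factorS /= !orbF.
  rewrite (neF c'.+2 c'); last lia.
  rewrite nbr_factor_pred !nbr_factor_neqS //.
  have := natr_subS_neq0 jc; have := natr_subS_neq0 jc1.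
  rewrite -!natr1 => h1 h2.
  by case: al' => /=; field; rewrite ?h1 ?h2.
have [jc|/eqP jc] := eqVneq j.+1 c.
  rewrite (negPf (hc jc)); subst c; apply: J => //; lia.
have [jd|/eqP jd] := eqVneq j.+1 d.
  rewrite (negPf (hd jd)) AC; subst d; apply: J => //; lia.
have [ecd|/eqP ecd] := eqVneq c.+1 d.
  rewrite (negPf (hcd ecd)); subst d; apply: K => //; lia.
have [edc|/eqP edc] := eqVneq d.+1 c.
  rewrite (negPf (hdc edc)) AC; subst c; apply: K => //; lia.
rewrite /A /lower_defect !(neF j.+1) // (neF c.+1) // (neF d.+1) // !orbF.
rewrite !nbr_factor_neqS //.
have := natr_subS_neq0 jc; have := natr_subS_neq0 jd.
have := natr_subS_neq0 ecd; have := natr_subS_neq0 edc => h1 h2 h3 h4.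
by case: al {hc hdc}; case: be {hd hcd} => /=; field; rewrite ?h1 ?h2 ?h3 ?h4.
Qed.

(** Here a and b are the letters of the twins y and y.+1, c is the letter of i;
al and be refer to the window of the twins, ga to the vertices between y.+1 and
i. *)
Definition upper_defect (al be ga : bool) (a b c : nat) : rat :=
  al%:R * (be || (a.+1 == b))%:R * nbr_factor a b
  * ((ga || (a.+1 == c) || (b.+1 == c))%:R * nbr_factor a c * nbr_factor b c
     + ga%:R - 2 * ((ga || (b.+1 == c))%:R * nbr_factor b c)).

(** The weights of the orders ab and ba are proportional to b - a + 1 and
b - a - 1. With Z = c - a - 1 and D = b - a, the identity behind the
cancellation is 1/(Z (Z - D)) = (1/(Z - D) - 1/Z)/D. *)
Lemma upper_defect_anti (al be ga : bool) (a b c : nat) :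
  (a.+1 = b -> ~~ be) -> (b.+1 = a -> ~~ al) ->
  (a.+1 = c -> ~~ ga) -> (b.+1 = c -> ~~ ga) ->
  upper_defect al be ga a b c + upper_defect be al ga b a c = 0.
Proof.
have neF (x y : nat) : x <> y -> (x == y) = false by move/eqP/negbTE.
pose A (al be : bool) (a b : nat) :=
  upper_defect al be ga a b c + upper_defect be al ga b a c.
have AC al' be' a' b' : A al' be' a' b' = A be' al' b' a' by exact: addrC.
rewrite -/(A al be a b) => hab hba hac hbc.
have [ab|/eqP ab] := eqVneq a b.
  by rewrite /A /upper_defect ab !nbr_factor_id !(mul0r, mulr0) addr0.
have J (al' : bool) (a' : nat) : (a'.+1 = c -> ~~ ga) -> (a'.+2 = c -> ~~ ga) ->
    A al' false a' a'.+1 = 0.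
  move=> hac' hbc'; rewrite /A /upper_defect eqxx nbr_factorS /= (neF a'.+2 a') ?mul0r; last lia.
  have [ac|/eqP ac] := eqVneq a'.+1 c.
    rewrite (negPf (hac' ac)) -ac nbr_factor_id nbr_factorS /= (neF a'.+2); last lia.
    by rewrite /=; ring.
  have [bc|/eqP bc] := eqVneq a'.+2 c.
    rewrite (negPf (hbc' bc)) -bc nbr_factorS nbr_factorSS.
    by case: al'; rewrite ?orbT /=; ring.
  rewrite !nbr_factor_neqS // !orbF.
  have := natr_subS_neq0 ac; have := natr_subS_neq0 bc.
  rewrite -!natr1 => h1 h2.
  by case: al'; case: ga {hac hbc hac' hbc' AC A} => /=; field; rewrite ?h1 ?h2.
have [eab|/eqP eab] := eqVneq a.+1 b.
  by rewrite (negPf (hab eab)); subst b; apply: J.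
have [eba|/eqP eba] := eqVneq b.+1 a.
  by rewrite (negPf (hba eba)) AC; subst a; apply: J.
have K (al' be' : bool) (a' b' : nat) : a' <> b' -> a'.+1 <> b' -> b'.+1 <> a' ->
    a'.+1 = c -> ~~ ga -> A al' be' a' b' = 0.
  move=> ab' abS baS ac /negPf gaF; rewrite /A /upper_defect gaF -ac eqxx.
  rewrite (neF a'.+1 b') // (neF b'.+1 a') // (neF b'.+1 a'.+1); last lia.
  rewrite nbr_factorS !nbr_factor_neqS //=; last lia.
  have := natr_subS_neq0 abS; have := natr_subS_neq0 baS; have := natr_sub_neq0 ab'.
  have : b'.+1 <> a'.+1 by lia.
  move/natr_subS_neq0; rewrite -!natr1 => h1 h2 h3 h4.
  by case: al'; case: be' => /=; field; rewrite ?h1 ?h2 ?h3 ?h4.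
have [ac|/eqP ac] := eqVneq a.+1 c; first by apply: K => //; exact: hac.
have [bc|/eqP bc] := eqVneq b.+1 c.
  by rewrite AC; apply: K => //; [lia | exact: hbc].
rewrite /A /upper_defect !(neF a.+1) // !(neF b.+1) // !orbF !nbr_factor_neqS //.
have := natr_subS_neq0 ac; have := natr_subS_neq0 bc.
have := natr_subS_neq0 eab; have := natr_subS_neq0 eba => h1 h2 h3 h4.
case: al {hba}; case: be {hab}; case: ga {hac hbc K J AC A} => /=; field;
  rewrite ?h1 ?h2 ?h3 ?h4 //.
Qed.

End ResidueIdentities.

Section Weights.
Variable n : nat.
Implicit Types (m : nat -> nat) (w : {ffun 'I_n -> 'I_n}) (S : pred 'I_n).

(** The possible poles of (1/z) prod_a (z - a)/(z - a - 1), for a running over the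
letters in S. Those where [insert_value] is nonzero are the columns that start a
block of zeros of delta. *)
Definition insertable S w (c : nat) : bool :=
  (c == 0) || [exists j, S j && ((w j).+1 == c)].

(** The residue at a pole c, when the letters in S are distinct. At
c = 0 the pole comes from the factor 1/z, which then contributes 1; and if c is
the letter of a vertex in S, one factor vanishes. *)
Definition insert_value S w (c : nat) : rat :=
  ((\prod_(j | S j) nbr_factor (w j) c) / (maxn c 1)%:R)%R.

Definition insert_weight S w (c : nat) : rat :=
  ((insertable S w c)%:R * insert_value S w c)%R.

Definition window m (i : 'I_n) : pred 'I_n := [pred j : 'I_n | m i <= j < i].

Definition word_weight m w : rat := (\prod_i insert_weight (window m i) w (w i))%R.

Lemma insertable_cons S S' k w c : (forall j, S' j = (j == k) || S j) ->
  insertable S' w c = insertable S w c || ((w k).+1 == c).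
Proof.
move=> SE; rewrite /insertable -orbA; congr (_ || _).
apply/existsP/orP => [[j /andP[]]|[/existsP[j /andP[Sj cj]]|ck]].
- rewrite SE => /predU1P[->|Sj] cj; first by right.
  by left; apply/existsP; exists j; rewrite Sj.
- by exists j; rewrite SE Sj orbT.
- by exists k; rewrite SE eqxx.
Qed.

Lemma insert_value_cons S S' k w c : ~~ S k -> (forall j, S' j = (j == k) || S j) ->
  (insert_value S' w c = nbr_factor (w k) c * insert_value S w c)%R.
Proof.
move=> Sk SE; rewrite /insert_value mulrA; congr (_ / _)%R.
rewrite (bigD1 k) ?SE ?eqxx //=; congr (_ * _)%R.
apply: eq_bigl => j; rewrite SE; have [->|] := eqVneq j k => /=.
  by rewrite (negPf Sk).
by rewrite andbT.
Qed.

Lemma insert_value_eq0 S k w c : S k -> w k = c :> nat -> insert_value S w c = 0%R.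
Proof. by move=> Sk <-; rewrite /insert_value (bigD1 k) //= nbr_factor_id !mul0r. Qed.

Lemma insertableF S w (x c : nat) : (forall k, S k -> w k != x :> nat) -> x.+1 = c ->
  ~~ insertable S w c.
Proof.
move=> Sx <-; rewrite /insertable /=; apply/existsPn => k; rewrite negb_and eqSS.
by case Sk: (S k) => //=; exact: Sx.
Qed.

Lemma eq_insert_weight S S' w c : S =1 S' -> insert_weight S w c = insert_weight S' w c.
Proof.
move=> SE; rewrite /insert_weight /insertable /insert_value (eq_bigl _ _ SE).
congr (_%:R * _)%R.
by congr (_ || _); apply: eq_existsb => j; rewrite SE.
Qed.

Lemma insertable_swap S a b w c : (forall j, S (tperm a b j) = S j) ->
  insertable S (swap a b w) c = insertable S w c.
Proof.
move=> SE; rewrite /insertable; congr (_ || _); apply/existsP/existsP => -[j].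
  by rewrite ffunE => H; exists (tperm a b j); rewrite SE.
by move=> H; exists (tperm a b j); rewrite ffunE tpermK SE.
Qed.

Lemma insert_value_swap S a b w c : (forall j, S (tperm a b j) = S j) ->
  insert_value S (swap a b w) c = insert_value S w c.
Proof.
move=> SE; rewrite /insert_value; congr (_ / _)%R.
rewrite [RHS](reindex_inj (@perm_inj _ (tperm a b))) /=.
by apply: eq_big => j; rewrite ?SE // ffunE.
Qed.

Lemma swap_closed (P : nat -> bool) (i : nat) (a b j : 'I_n) :
  a = i :> nat -> b = i.+1 :> nat -> P i = P i.+1 ->
  P (tperm a b j) = P j.
Proof. by move=> ai bi Pi; case: tpermP => [->|->|_ _] //; rewrite ?ai ?bi. Qed.

(** A window that does not begin at i.+1 contains both twins or neither, so
exchanging their letters does not change the weight of a later vertex. *)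
Lemma prod_insert_weight_swap m (Q : pred 'I_n) (i : nat) (a b : 'I_n) w :
  a = i :> nat -> b = i.+1 :> nat ->
  (forall t, Q t -> [/\ t != a, t != b & m t != i.+1]) ->
  (\prod_(t | Q t) insert_weight (window m t) (swap a b w) (swap a b w t)
   = \prod_(t | Q t) insert_weight (window m t) w (w t))%R.
Proof.
move=> ai bi Qt; apply: eq_bigr => t /Qt[ta tb mt].
have winE j : window m t (tperm a b j) = window m t j.
  apply: (@swap_closed (fun x => m t <= x < t) i) => //.
  have : t != i :> nat by rewrite -ai.
  have : t != i.+1 :> nat by rewrite -bi.
  lia.
by rewrite /insert_weight insertable_swap // insert_value_swap // ffunE tpermD // eq_sym.
Qed.

Variables (V : lmodType rat) (G : {ffun 'I_n -> 'I_n} -> V).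
Hypothesis G_swap : forall a b w, G (swap a b w) = G w.

Definition word_sum m : V := (\sum_w word_weight m w *: G w)%R.

(** G stands for a function of the shape of w, which does not change when two
letters are exchanged; so only the weights matter. *)
Lemma word_sum_second_difference m0 m1 m2 (a b : 'I_n) :
  (forall w, word_weight m0 w + word_weight m2 w - 2 * word_weight m1 w
     = - (word_weight m0 (swap a b w) + word_weight m2 (swap a b w)
          - 2 * word_weight m1 (swap a b w)))%R ->
  (word_sum m0 + word_sum m2 = 2 *: word_sum m1)%R.
Proof.
move=> H; apply/eqP; rewrite -subr_eq0; apply/eqP.
rewrite /word_sum scaler_sumr -big_split -sumrB /=.
under eq_bigr => w _ do rewrite scalerA -scalerDl -scalerBl.
apply: (@sum_swap_anti _ _ _ a b) => w.
by rewrite G_swap [in RHS]H scaleNr opprK.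
Qed.

Lemma word_sum_lower m i y : i.+1 < n ->
  hessenberg n (upd (upd m i y) i.+1 y) ->
  hessenberg n (upd (upd m i y.+1) i.+1 y.+1) ->
  (forall t, t < n -> m t != i.+1) ->
  (word_sum (upd (upd m i y) i.+1 y) + word_sum (upd (upd m i y.+1) i.+1 y.+1)
     = 2 *: word_sum (upd (upd m i y) i.+1 y.+1))%R.
Proof.
move=> i1n h0 h2 mN.
have iN : i < n by lia.
have yi : y < i by have := h2.1 i iN; rewrite /upd ltn_eqF ?eqxx.
have yn : y < n by lia.
pose a := Ordinal iN; pose b := Ordinal i1n; pose k0 := Ordinal yn.
have vE (u v : 'I_n) : (u == v) = (u == v :> nat) by [].
have ba : b != a by rewrite vE /=; lia.
pose S : pred 'I_n := [pred j : 'I_n | y < j < i].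
pose C w :=
  (\prod_(t | (t != a) && (t != b)) insert_weight (window m t) w (w t))%R.
have Sa : ~~ S a by rewrite /S /=; lia.
have Sk : ~~ S k0 by rewrite /S /=; lia.
have SE j : S (tperm a b j) = S j.
  by apply: (@swap_closed (fun x => y < x < i) i) => //; lia.
pose Sy : pred 'I_n := [pred j : 'I_n | y <= j < i].
have SyE j : Sy j = (j == k0) || S j by rewrite vE /Sy /S /=; lia.
have Sya : ~~ Sy a by rewrite /Sy /=; lia.
have wE p q w : word_weight (upd (upd m i p) i.+1 q) w
    = (insert_weight [pred j : 'I_n | (p <= j < i)%N] w (w a)
       * (insert_weight [pred j : 'I_n | (q <= j < i.+1)%N] w (w b) * C w))%R.
  rewrite /word_weight (bigD1 a) //= (bigD1 b) //=; congr (_ * (_ * _))%R.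
  - by apply: eq_insert_weight => j; rewrite /window /= /upd ltn_eqF ?eqxx.
  - by apply: eq_insert_weight => j; rewrite /window /= /upd eqxx.
  apply: eq_bigr => t /andP[ta tb]; apply: eq_insert_weight => j.
  by rewrite /window /= /upd (negPf (ta : t != i :> nat)) (negPf (tb : t != i.+1 :> nat)).
have rhoS w c : insert_weight [pred j : 'I_n | (y < j < i)%N] w c
    = ((insertable S w c)%:R * insert_value S w c)%R by [].
have rhoSy w c : insert_weight [pred j : 'I_n | (y <= j < i)%N] w c
    = ((insertable S w c || ((w k0).+1 == c))%:R
       * (nbr_factor (w k0) c * insert_value S w c))%R.
  by rewrite /insert_weight (insertable_cons _ _ SyE) (insert_value_cons _ _ Sk SyE).
have rhoSa w c : insert_weight [pred j : 'I_n | (y < j < i.+1)%N] w c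
    = ((insertable S w c || ((w a).+1 == c))%:R
       * (nbr_factor (w a) c * insert_value S w c))%R.
  have SaE (j : 'I_n) : (y < j < i.+1) = (j == a) || S j by rewrite vE /S /=; lia.
  by rewrite /insert_weight (insertable_cons _ _ SaE) (insert_value_cons _ _ Sa SaE).
have rhoSya w c : insert_weight [pred j : 'I_n | (y <= j < i.+1)%N] w c
    = ((insertable S w c || ((w k0).+1 == c) || ((w a).+1 == c))%:R
       * (nbr_factor (w a) c * (nbr_factor (w k0) c * insert_value S w c)))%R.
  have SaE (j : 'I_n) : (y <= j < i.+1) = (j == a) || Sy j by rewrite vE /Sy /=; lia.
  rewrite /insert_weight (insertable_cons _ _ SaE) (insert_value_cons _ _ Sya SaE).
  by rewrite (insertable_cons _ _ SyE) (insert_value_cons _ _ Sk SyE).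
have diffE w : (word_weight (upd (upd m i y) i.+1 y) w
      + word_weight (upd (upd m i y.+1) i.+1 y.+1) w
      - 2 * word_weight (upd (upd m i y) i.+1 y.+1) w
    = C w * insert_value S w (w a) * insert_value S w (w b)
      * lower_defect (insertable S w (w a)) (insertable S w (w b)) (w k0) (w a) (w b))%R.
  by rewrite !wE rhoS !rhoSy !rhoSa rhoSya /lower_defect; ring.
apply: (@word_sum_second_difference _ _ _ a b) => w; rewrite !diffE.
have -> : C (swap a b w) = C w.
  apply: (prod_insert_weight_swap (i := i)) => // t /andP[ta tb].
  by rewrite mN.
rewrite !insert_value_swap // !insertable_swap // !ffunE tpermL tpermR.
rewrite tpermD; try by rewrite vE /=; lia.
apply/eqP; rewrite -addr_eq0 [X in (_ + X * _)%R]mulrAC -mulrDr.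
have [/existsP[k /andP[Sk' /eqP wk]]|nk] := boolP [exists k, S k && (w k == w k0)].
  (* A vertex of S has y in its window, so it avoids the letter of y. *)
  suff -> : C w = 0%R by rewrite !mul0r.
  rewrite /C (bigD1 k) /=; last by rewrite !vE /=; move: Sk'; rewrite /S /=; lia.
  rewrite /insert_weight (@insert_value_eq0 _ k0) ?mulr0 ?mul0r ?wk //.
  rewrite /window /=; move: Sk'; rewrite /S /= => /andP[yk ki]; rewrite yk andbT.
  have := h0.2 k i (ltnW ki) iN; rewrite /upd eqxx (ltn_eqF ki).
  by rewrite (ltn_eqF (ltnSn i)) ltn_eqF //; lia.
have [/existsP[k /andP[Sk' /eqP wk]]|na] := boolP [exists k, S k && (w k == w a)].
  by rewrite (@insert_value_eq0 S k) ?mulr0 ?mul0r // wk.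
have [/existsP[k /andP[Sk' /eqP wk]]|nb] := boolP [exists k, S k && (w k == w b)].
  by rewrite (@insert_value_eq0 S k _ (w b)) ?mulr0 ?mul0r // wk.
have absent (x : 'I_n) : ~~ [exists k, S k && (w k == w x)] ->
    forall k, S k -> w k != w x :> nat.
  by move=> /existsPn H k Sk'; have := H k; rewrite Sk'.
rewrite lower_defect_anti ?mulr0 //.
- exact: insertableF (absent _ nk).
- exact: insertableF (absent _ nk).
- exact: insertableF (absent _ na).
- exact: insertableF (absent _ nb).
Qed.

Lemma word_sum_upper m i y : i < n -> hessenberg n (upd m i y) ->
  hessenberg n (upd m i y.+2) -> m y = m y.+1 ->
  (word_sum (upd m i y) + word_sum (upd m i y.+2) = 2 *: word_sum (upd m i y.+1))%R.
Proof.
move=> ilt h0 h2 mE; have [yi mN mlo] := hessenberg_upd_between ilt h0 h2.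
have [y1n yn] : y.+1 < n /\ y < n by lia.
pose a := Ordinal yn; pose b := Ordinal y1n; pose k0 := Ordinal ilt.
have vE (u v : 'I_n) : (u == v) = (u == v :> nat) by [].
have ba : b != a by rewrite vE /=; lia.
have kab : (k0 != a) && (k0 != b) by rewrite !vE /=; lia.
pose T : pred 'I_n := window m a.
pose S : pred 'I_n := [pred j : 'I_n | y.+1 < j < i].
pose C w :=
  (\prod_(t | [&& t != a, t != b & t != k0]) insert_weight (window m t) w (w t))%R.
have Ta : ~~ T a by rewrite /T /window /=; lia.
have Sa : ~~ S a by rewrite /S /=; lia.
have Sb : ~~ S b by rewrite /S /=; lia.
have my : m y <= y by apply: mlo => //; lia.
have SE j : S (tperm a b j) = S j.
  by apply: (@swap_closed (fun x => y.+1 < x < i) y) => //; lia.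
have TE j : T (tperm a b j) = T j.
  by apply: (@swap_closed (fun x => m y <= x < y) y) => //; lia.
have rhoTb w c : insert_weight (window m b) w c
    = ((insertable T w c || ((w a).+1 == c))%:R
       * (nbr_factor (w a) c * insert_value T w c))%R.
  have E j : window m b j = (j == a) || T j by rewrite vE /T /window /= -mE; lia.
  by rewrite /insert_weight (insertable_cons _ _ E) (insert_value_cons _ _ Ta E).
have wE p w : word_weight (upd m i p) w
    = (insert_weight T w (w a) * (insert_weight (window m b) w (w b)
              * (insert_weight [pred j : 'I_n | (p <= j < i)%N] w (w k0) * C w)))%R.
  rewrite /word_weight (bigD1 a) //= (bigD1 b) //= (bigD1 k0) //=.
  congr (_ * (_ * (_ * _)))%R.
  - by apply: eq_insert_weight => j; rewrite /T /window /= /upd ltn_eqF //; lia.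
  - by apply: eq_insert_weight => j; rewrite /window /= /upd ltn_eqF //.
  - by apply: eq_insert_weight => j; rewrite /window /= /upd eqxx.
  apply: eq_big => [t|t /andP[_ tk]]; first by rewrite andbA.
  apply: eq_insert_weight => j.
  by rewrite /window /= /upd (negPf (tk : t != i :> nat)).
have rhoS w c : insert_weight [pred j : 'I_n | (y.+1 < j < i)%N] w c
    = ((insertable S w c)%:R * insert_value S w c)%R by [].
have SbE (j : 'I_n) : (y < j < i) = (j == b) || S j by rewrite vE /S /=; lia.
have rhoSb w c : insert_weight [pred j : 'I_n | (y < j < i)%N] w c
    = ((insertable S w c || ((w b).+1 == c))%:R
       * (nbr_factor (w b) c * insert_value S w c))%R.
  by rewrite /insert_weight (insertable_cons _ _ SbE) (insert_value_cons _ _ Sb SbE).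
have rhoSab w c : insert_weight [pred j : 'I_n | (y <= j < i)%N] w c
    = ((insertable S w c || ((w a).+1 == c) || ((w b).+1 == c))%:R
       * (nbr_factor (w b) c * (nbr_factor (w a) c * insert_value S w c)))%R.
  pose S' : pred 'I_n := fun j => (j == a) || S j.
  have E (j : 'I_n) : (y <= j < i) = (j == b) || S' j by rewrite /S' /S !vE /=; lia.
  have Sb' : ~~ S' b by rewrite /S' (negPf Sb) (negPf ba).
  rewrite /insert_weight (insertable_cons _ _ E) (insert_value_cons _ _ Sb' E).
  by rewrite (insertable_cons (k := a) (S := S)) // (insert_value_cons (k := a) (S := S)).
have diffE w : (word_weight (upd m i y) w + word_weight (upd m i y.+2) w
      - 2 * word_weight (upd m i y.+1) w
    = C w * insert_value T w (w a) * insert_value T w (w b) * insert_value S w (w k0)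
      * upper_defect (insertable T w (w a)) (insertable T w (w b)) (insertable S w (w k0))
          (w a) (w b) (w k0))%R.
  by rewrite !wE rhoS rhoSb rhoSab rhoTb /insert_weight /upper_defect; ring.
apply: (@word_sum_second_difference _ _ _ a b) => w; rewrite !diffE.
have -> : C (swap a b w) = C w.
  apply: (prod_insert_weight_swap (i := y)) => // t /and3P[ta tb tk].
  by rewrite mN.
have [ka kb] := andP kab.
rewrite !insert_value_swap // !insertable_swap // !ffunE tpermL tpermR.
rewrite tpermD; [| by rewrite eq_sym | by rewrite eq_sym].
apply/eqP; rewrite -addr_eq0 [X in (_ + X * _ * _)%R]mulrAC -mulrDr.
(* A vertex of S has both twins in its window, so it avoids their letters. *)
have seen k x : S k -> (x == a) || (x == b) -> w k = w x -> C w = 0%R.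
  move=> Sk xab wk; rewrite /C (bigD1 k) /=; last first.
    by rewrite !vE /=; move: Sk; rewrite /S /=; lia.
  rewrite /insert_weight (@insert_value_eq0 _ x) ?mulr0 ?mul0r ?wk //.
  move: Sk; rewrite /window /S /= => /andP[yk ki].
  have := mlo k (ltn_ord k) ki.
  by case/orP: xab => /eqP-> /=; lia.
have [/existsP[k /andP[Sk' /eqP wk]]|na] := boolP [exists k, S k && (w k == w a)].
  by rewrite (seen k a) ?eqxx ?mul0r.
have [/existsP[k /andP[Sk' /eqP wk]]|nb] := boolP [exists k, S k && (w k == w b)].
  by rewrite (seen k b) ?eqxx ?orbT ?mul0r.
have [/existsP[k /andP[Tk /eqP wk]]|nTa] := boolP [exists k, T k && (w k == w a)].
  by rewrite (@insert_value_eq0 T k) ?mulr0 ?mul0r // wk.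
have [/existsP[k /andP[Tk /eqP wk]]|nTb] := boolP [exists k, T k && (w k == w b)].
  by rewrite (@insert_value_eq0 T k _ (w b)) ?mulr0 ?mul0r // wk.
have absent (R : pred 'I_n) (x : 'I_n) : ~~ [exists k, R k && (w k == w x)] ->
    forall k, R k -> w k != w x :> nat.
  by move=> /existsPn H k Rk; have := H k; rewrite Rk.
rewrite upper_defect_anti ?mulr0 //.
- exact: insertableF (absent _ _ nTa).
- exact: insertableF (absent _ _ nTb).
- exact: insertableF (absent _ _ na).
- exact: insertableF (absent _ _ nb).
Qed.

End Weights.

(** * Hikita's formula at q = 1 *)

Section Cat.
Variables (a b : nat) (T : finType).

Definition ffun_cat (p : {ffun 'I_a -> T} * {ffun 'I_b -> T}) : {ffun 'I_(a + b) -> T} :=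
  [ffun i => match split i with inl j => p.1 j | inr j => p.2 j end].

Lemma ffun_catl p j : ffun_cat p (lshift b j) = p.1 j.
Proof. by rewrite ffunE (unsplitK (inl j)). Qed.

Lemma ffun_catr p j : ffun_cat p (rshift a j) = p.2 j.
Proof. by rewrite ffunE (unsplitK (inr j)). Qed.

Lemma ffun_cat_bij : bijective ffun_cat.
Proof.
exists (fun f : {ffun 'I_(a + b) -> T} =>
  ([ffun j : 'I_a => f (lshift b j)], [ffun j : 'I_b => f (rshift a j)])) => [[g h]|f].
  by congr (_, _); apply/ffunP=> j; rewrite ffunE ?ffun_catl ?ffun_catr.
apply/ffunP=> i; rewrite ffunE; case: split_ordP => j ->; by rewrite ffunE.
Qed.
End Cat.

Definition fact_e N (k : nat) : {mpoly rat[N]} := (k`!%:R *: mesym N rat k)%R.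

(** Group the injective colourings of a clique by their set of colours. *)
Lemma sum_inj_fact_e b N :
  (\sum_(h : {ffun 'I_b -> 'I_N} | injectiveb h) \prod_i 'X_(h i) = fact_e N b)%R.
Proof.
rewrite /fact_e /mesym scaler_sumr.
rewrite (partition_big (fun h : {ffun 'I_b -> 'I_N} => h @: 'I_b)
  (fun A : {set 'I_N} => #|A| == b)) /=; last first.
  by move=> h /injectiveP hinj; rewrite card_imset // card_ord.
apply: eq_bigr => A /eqP cardA.
rewrite (eq_bigr (fun=> \prod_(i in A) 'X_i)%R); last first.
  move=> h /andP[/injectiveP hinj /eqP <-]; rewrite big_imset //=.
  by move=> x y _ _; exact: hinj.
rewrite sumr_const scaler_nat; congr (_ *+ _)%R.
have := card_inj_ffuns_on 'I_b (mem A); rewrite cardA card_ord ffactnn => <-.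
rewrite cardsE; apply: eq_card => h; rewrite [LHS]unfold_in [RHS]unfold_in /=.
rewrite andbC; apply/andP/andP => -[h1 h2]; split => //.
  by apply/ffun_onP=> i; rewrite -(eqP h1) imset_f.
have hinj := injectiveP _ h2.
rewrite eqEcard card_imset // card_ord cardA leqnn andbT.
by apply/subsetP=> _ /imsetP[i _ ->]; exact: (ffun_onP h1).
Qed.

Lemma chromQ_clique a b N m :
  (forall i, i < a -> m i <= i) -> (forall i, a <= i < a + b -> m i = a) ->
  chromQ (a + b) N m = (chromQ a N m * fact_e N b)%R.
Proof.
move=> mlo mblk; rewrite -sum_inj_fact_e /chromQ big_distrlr /=.
rewrite pair_big /= (reindex (@ffun_cat a b 'I_N)) /=; last first.
  by apply: onW_bij; exact: ffun_cat_bij.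
apply: eq_big => [[g h]|[g h] _] /=; last first.
  by rewrite big_split_ord /=; congr (_ * _)%R; apply: eq_bigr => i _;
    rewrite ?ffun_catl ?ffun_catr.
apply/forallP/andP => [H|[/forallP Hg /injectiveP Hh] u].
  split.
    apply/forallP=> u; apply/forallP=> v; apply/implyP=> uv.
    have /forallP/(_ (lshift b v))/implyP := H (lshift b u).
    by rewrite !ffun_catl; apply.
  apply/injectiveP=> u v; apply: contra_eq => uv.
  have /forallP/(_ (rshift a v))/implyP := H (rshift a u).
  rewrite !ffun_catr; apply.
  have uv' : (u : nat) <> v by move/val_inj/eqP; rewrite (negPf uv).
  have [ub vb] := (ltn_ord u : u < b, ltn_ord v : v < b).
  by rewrite /adjacent /= !mblk; lia.
apply/forallP=> v; apply/implyP.
case: (split_ordP u) => u' ->; case: (split_ordP v) => v' -> => uv.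
- rewrite !ffun_catl; have /forallP/(_ v')/implyP := Hg u'; exact.
- have [ua vb] := (ltn_ord u' : u' < a, ltn_ord v' : v' < b).
  move: uv; rewrite /adjacent /= (mblk (a + v')); last by lia.
  by have := mlo u' ua; lia.
- have [ub va] := (ltn_ord u' : u' < b, ltn_ord v' : v' < a).
  move: uv; rewrite /adjacent /= (mblk (a + u')); last by lia.
  by have := mlo v' va; lia.
- rewrite !ffun_catr; apply/eqP=> /Hh uv'; move: uv; rewrite uv' /adjacent; lia.
Qed.

Lemma eq_chromQ n N m m' : (forall i, i < n -> m i = m' i) ->
  chromQ n N m = chromQ n N m'.
Proof.
move=> mm; apply: eq_bigl => k; apply: eq_forallb => u; apply: eq_forallb => v.
by rewrite /adjacent !mm.
Qed.

Lemma clique_union_const n m : hessenberg n m -> clique_union n m ->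
  forall i j, i < n -> m i <= j <= i -> m j = m i.
Proof.
move=> hm bm; elim=> [|i IHi] j iN; first by have := hm.1 0 iN; case: j => //; lia.
move=> /andP[mj]; rewrite leq_eqVlt => /orP[/eqP->//|ji].
have [mi|[_ mi]] := bm i.+1 iN; first by lia.
by rewrite /= in mi; rewrite mi; apply: IHi; lia.
Qed.

(** B lists the sizes of the cliques. The counts on the right are the column
heights of the word whose i-th letter is i - m i. *)
Lemma clique_union_sizes n N m : hessenberg n m -> clique_union n m ->
  exists B : seq nat, [/\ chromQ n N m = (\prod_(k <- B) fact_e N k)%R
    & forall c, count (fun k => c < k) B = count (fun i => i - m i == c) (iota 0 n)].
Proof.
elim/ltn_ind: n => -[|n] IHn hm bm.
  exists [::]; split=> //; rewrite big_nil /chromQ.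
  rewrite (big_pred1 (ffun0 (aT := 'I_0) (rT := fun=> 'I_N) (card_ord 0)))
    ?big_ord0 // => k /=.
  have -> : is_proper m k by apply/forallP=> -[].
  by apply/esym/eqP/ffunP=> -[].
have mE := clique_union_const hm bm; pose s := m n; pose b := n.+1 - s.
have sn : s <= n by exact: hm.1.
have nE : n.+1 = s + b by rewrite /b; lia.
have mblk i : s <= i < s + b -> m i = s by move=> ilt; apply: mE => //; lia.
have [||B [HB Bc]] := IHn s sn.
- by split=> [i ilt|i j ij jlt]; [apply: hm.1; lia | apply: hm.2; lia].
- by move=> i ilt; apply: bm; lia.
exists (b :: B); split=> [|c].
- rewrite nE chromQ_clique // ?HB ?big_cons 1?mulrC // => i ilt.
  by apply: hm.1; lia.
transitivity ((c < b) + count (fun k => c < k) B) => //.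
rewrite Bc nE iotaD count_cat add0n addnC; congr (_ + _).
rewrite (@eq_in_count _ _ (fun i => i - s == c)); last first.
  by move=> i; rewrite mem_iota => ilt /=; rewrite mblk.
rewrite -[X in iota X]addn0 iotaDl count_map.
rewrite (@eq_count _ _ (pred1 c)); last by move=> i /=; rewrite addKn.
by rewrite count_uniq_mem ?iota_uniq // mem_iota.
Qed.

(** The counts are the parts of the conjugate partition. *)
Lemma count_gt_inj (s t : seq nat) :
  (forall c, count (fun k => c < k) s = count (fun k => c < k) t) ->
  perm_eq (filter (leq 1) s) (filter (leq 1) t).
Proof.
move=> st; apply/allP=> -[|v] _ /=.
  by rewrite !count_filter !(@eq_count _ _ pred0) ?count_pred0 => [|[]|[]].
have cE (u : seq nat) : count_mem v.+1 u
    = count (fun k => v < k) u - count (fun k => v.+1 < k) u.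
  elim: u => //= k u ->.
  have : count (fun k => v.+1 < k) u <= count (fun k => v < k) u.
    by apply: sub_count => i /=; lia.
  lia.
rewrite !count_filter.
have fE (u : seq nat) : count (predI (pred1 v.+1) (leq 1)) u = count_mem v.+1 u.
  by apply: eq_count => k /=; case: eqP => [->|].
by rewrite !fE !cE !st.
Qed.

Lemma prod_filter_pos (R : comNzRingType) (F : nat -> R) (s : seq nat) :
  F 0 = 1%R -> (\prod_(k <- filter (leq 1) s) F k = \prod_(k <- s) F k)%R.
Proof.
move=> F0; rewrite big_filter [RHS](bigID (leq 1)) /= [X in (_ * X)%R]big1 ?mulr1 //.
by case.
Qed.

Lemma card_ord_lt n v : v <= n -> #|[pred c : 'I_n | c < v]| = v.
Proof. by move=> vn; rewrite -sum1_card (big_ord_narrow vn) sum1_card card_ord. Qed.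

Lemma count_lt_iota n h : h <= n -> count (fun r => r < h) (iota 0 n) = h.
Proof.
move=> hn; rewrite -(subnKC hn) iotaD count_cat.
rewrite [X in X + _](@eq_in_count _ _ predT); last first.
  by move=> r; rewrite mem_iota.
rewrite [X in _ + X](@eq_in_count _ _ pred0); last first.
  by move=> r; rewrite mem_iota /=; lia.
by rewrite count_predT count_pred0 size_iota addn0.
Qed.

Section Shape.
Variable n : nat.
Implicit Types w : {ffun 'I_n -> 'I_n}.

Definition height w (c : nat) : nat := #|[pred i | w i == c :> nat]|.

(** The rows of a shape whose columns have the heights of w; as a cardinal, this
makes sense for a word that is not the record of a tableau. *)
Definition row_length w (r : nat) : nat := #|[pred c : 'I_n | r < height w c]|.

Definition row_lengths w : seq nat := [seq row_length w r | r <- iota 0 n].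

Lemma height_le w c : height w c <= n.
Proof. by rewrite -[leqRHS]card_ord max_card. Qed.

Lemma height_swap a b w c : height (swap a b w) c = height w c.
Proof.
rewrite /height -!sum1_card (reindex_inj (@perm_inj _ (tperm a b))) /=.
by apply: eq_bigl => i; rewrite !inE ffunE tpermK.
Qed.

Lemma row_length_gt w r v : {homo height w : c d / c <= d >-> d <= c} ->
  v < n -> (v < row_length w r) = (r < height w v).
Proof.
move=> hdec vn; rewrite /row_length; apply/idP/idP => [|rv].
  apply: contraLR; rewrite -!leqNgt => hv.
  have -> : v = #|[pred c : 'I_n | c < v]|.
    by rewrite card_ord_lt // ltnW.
  apply: subset_leq_card; apply/subsetP=> c; rewrite !inE => rc.
  by rewrite ltnNge; apply/negP => /hdec; lia.
have -> : v.+1 = #|[pred c : 'I_n | c < v.+1]|.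
  by rewrite card_ord_lt.
apply: subset_leq_card; apply/subsetP=> c; rewrite !inE ltnS => /hdec.
exact: leq_trans.
Qed.

(** Empty rows contribute 0! e_0 = 1. *)
Definition word_term N w : {mpoly rat[N]} := (\prod_(k <- row_lengths w) fact_e N k)%R.

Lemma fact_e0 N : fact_e N 0 = 1%R.
Proof. by rewrite /fact_e mesym0E scale1r. Qed.

Lemma count_row_lengths w v : {homo height w : c d / c <= d >-> d <= c} ->
  count (fun k => v < k) (row_lengths w) = height w v.
Proof.
move=> hdec; rewrite /row_lengths count_map.
have [vn|nv] := ltnP v n; last first.
  rewrite (@eq_count _ _ pred0) ?count_pred0 => [|r /=]; last first.
    have : row_length w r <= n by rewrite -[leqRHS]card_ord max_card.
    lia.
  apply/esym/eqP/pred0P => i /=.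
  by have := ltn_ord (w i); lia.
rewrite (@eq_count _ _ (fun r => r < height w v)) => [|r /=].
  by rewrite count_lt_iota // height_le.
by rewrite row_length_gt.
Qed.

Lemma word_term_blocks N w (B : seq nat) :
  (forall c, count (fun k => c < k) B = height w c) ->
  word_term N w = (\prod_(k <- B) fact_e N k)%R.
Proof.
move=> Bh; rewrite /word_term -(prod_filter_pos _ (fact_e0 N)).
rewrite -[RHS](prod_filter_pos _ (fact_e0 N)); apply: perm_big.
apply: count_gt_inj => v; rewrite Bh count_row_lengths // => c d cd.
by rewrite -!Bh; apply: sub_count => k /=; lia.
Qed.

(** In a clique the letters 0, ..., t - 1 are already in use when t is inserted;
the product telescopes. *)
Lemma prod_nbr_factor t s : s < t ->
  (\prod_(0 <= a < s) nbr_factor a t = t%:R / (t%:R - s%:R))%R.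
Proof.
elim: s => [|s IHs] st.
  by rewrite big_geq // subr0 divff // pnatr_eq0; lia.
rewrite big_nat_recr //= IHs; last by lia.
rewrite nbr_factor_neqS; last by lia.
have h1 : (t%:R - s%:R != 0 :> rat)%R by apply: natr_sub_neq0; lia.
have h2 : (t%:R - s%:R - 1 != 0 :> rat)%R by apply: natr_subS_neq0; lia.
have -> : (t%:R - s.+1%:R = t%:R - s%:R - 1 :> rat)%R by rewrite -natr1; ring.
by field; rewrite h1 h2.
Qed.

Lemma prod_nbr_factor_all t : (\prod_(0 <= a < t) nbr_factor a t = (maxn t 1)%:R)%R.
Proof.
case: t => [|t]; first by rewrite big_geq.
rewrite big_nat_recr //= prod_nbr_factor // nbr_factorS mulr1 -natr1.
by rewrite [(_ + 1 - _)%R]addrAC subrr add0r divr1 natr1; congr _%:R%R; lia.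
Qed.

Variable m : nat -> nat.
Hypotheses (hm : hessenberg n m) (bm : clique_union n m).

Let clique_word (i : 'I_n) : 'I_n :=
  Ordinal (leq_ltn_trans (leq_subr (m i) i) (ltn_ord i)).

(** Inside a clique all previous letters are active, so each vertex is forced
into the first column that the clique has not used. *)
Lemma word_weight_clique_eq0 w : w != finfun clique_word -> word_weight m w = 0%R.
Proof.
apply: contra_neq_eq => Ww.
have rho_neq0 i : insert_weight (window m i) w (w i) != 0%R.
  by move: Ww; rewrite /word_weight (bigD1 i) //= mulf_eq0 negb_or => /andP[].
have mE := clique_union_const hm bm.
suff H k : forall i : 'I_n, i < k -> w i = i - m i :> nat.
  by apply/ffunP=> i; apply: val_inj; rewrite ffunE /= (H i.+1).
elim: k => // k IHk i; rewrite ltnS => ik.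
have := rho_neq0 i; rewrite /insert_weight mulf_eq0 negb_or pnatr_eq0 eqb0 negbK.
case/andP=> pi ci.
have wj (j : 'I_n) : m i <= j < i -> w j = j - m i :> nat.
  move=> ji; rewrite IHk; last by lia.
  by rewrite (mE i) //; lia.
have ge : i - m i <= w i.
  rewrite leqNgt; apply/negP=> lt.
  have jn : m i + w i < n by have := ltn_ord i; lia.
  move/eqP: ci; apply.
  apply: (@insert_value_eq0 _ _ (Ordinal jn)); first by rewrite /window /=; lia.
  by rewrite wj /=; lia.
case/orP: pi => [/eqP w0|/existsP[j /andP[ji /eqP wji]]]; first by lia.
by move: wji; rewrite wj //; move: ji; rewrite /window /=; lia.
Qed.

Lemma word_weight_clique : word_weight m (finfun clique_word) = 1%R.
Proof.
have mE := clique_union_const hm bm.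
rewrite /word_weight big1 // => i _; rewrite ffunE /insert_weight.
have mi : m i <= i by apply: hm.1.
have -> : insertable (window m i) (finfun clique_word) (clique_word i).
  rewrite /insertable /=; have [->//|/eqP im] := eqVneq (i - m i) 0 => /=.
  have jn : i.-1 < n by have := ltn_ord i; lia.
  apply/existsP; exists (Ordinal jn); rewrite ffunE /window /=.
  rewrite (mE i) //; lia.
rewrite mul1r /insert_value /=.
rewrite (eq_bigr (fun j : 'I_n => nbr_factor (j - m i) (i - m i))); last first.
  move=> j; rewrite /window /= => ji; rewrite ffunE /=.
  by rewrite (mE i) //; lia.
have -> : (\prod_(j < n | window m i j) nbr_factor (j - m i) (i - m i)
    = \prod_(m i <= j < i) nbr_factor (j - m i) (i - m i))%R.
  rewrite (big_nat_widenl _ 0) // (big_nat_widen _ _ n) ?big_mkord //.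
  exact: ltnW (ltn_ord i).
rewrite -{1}[m i]add0n big_addn.
under eq_bigr => j _ do rewrite addnK.
by rewrite prod_nbr_factor_all divff // pnatr_eq0; lia.
Qed.

Lemma word_sum_clique N :
  word_sum (word_term N) m = word_term N (finfun clique_word).
Proof.
rewrite /word_sum (bigD1 (finfun clique_word)) //= word_weight_clique scale1r.
by rewrite big1 ?addr0 // => w /word_weight_clique_eq0->; rewrite scale0r.
Qed.

Lemma chromQ_clique_union N : chromQ n N m = word_sum (word_term N) m.
Proof.
have [B [-> Bc]] := clique_union_sizes N hm bm.
rewrite word_sum_clique (@word_term_blocks N _ B) // => c; rewrite Bc /height.
rewrite -sum1_card -sum1_count big_mkcond /= [RHS]big_mkcond /=.
rewrite -[X in iota 0 X]subn0 -/(index_iota 0 n) big_mkord.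
by apply: eq_bigr => i _; rewrite inE ffunE.
Qed.

Lemma word_term_swap N a b w : word_term N (swap a b w) = word_term N w.
Proof.
rewrite /word_term /row_lengths; congr (\prod_(k <- _) _)%R.
apply: eq_map => r; apply: eq_card => c; rewrite !inE.
by rewrite height_swap.
Qed.

End Shape.

Lemma eq_word_sum n N m m' : (forall i, i < n -> m i = m' i) ->
  word_sum (@word_term n N) m = word_sum (@word_term n N) m'.
Proof.
move=> mm; apply: eq_bigr => w _; congr (_ *: _)%R.
by apply: eq_bigr => i _; apply: eq_insert_weight => j; rewrite /window /= mm.
Qed.

(** Hikita's formula, specialised at q = 1. The law is applied to each
coefficient of the difference. *)
Theorem chromQ_word_sum n N m : hessenberg n m ->
  chromQ n N m = word_sum (@word_term n N) m.
Proof.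
move=> hm; apply/eqP; rewrite -subr_eq0; apply/eqP/mpolyP=> mon; rewrite mcoeff0.
pose f m' : rat := ((chromQ n N m' - word_sum (@word_term n N) m')@_mon)%R.
have G_swap := @word_term_swap n N.
apply: (@modular_eq0 n f) hm => [|m' hm' bm']; last first.
  by rewrite /f (chromQ_clique_union hm' bm') subrr mcoeff0.
have fE m1 m2 m3 : (chromQ n N m1 + chromQ n N m3 = 2 * chromQ n N m2)%R ->
    (word_sum (@word_term n N) m1 + word_sum (@word_term n N) m3
      = 2 *: word_sum (@word_term n N) m2)%R ->
    (f m1 + f m3 = 2 * f m2)%R.
  move=> E1 E2; rewrite /f -mcoeffD addrACA -opprD E1 E2.
  by rewrite mulr_natl scaler_nat -mulrnBl mcoeffMn mulr_natl.
split=> [m1 m2 mm|m1 i y iN h0 h2 my|m1 i y iN h0 h2 mN].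
- by rewrite /f (eq_chromQ N mm) (eq_word_sum N mm).
- by apply: fE; [exact: chromQ_upper | exact: word_sum_upper].
- by apply: fE; [exact: chromQ_lower | exact: word_sum_lower].
Qed.

(** * The coefficients in the basis of elementary symmetric functions *)

Definition hess_fun n (m : revHess n) (i : nat) : nat := oapp m 0 (insub i).

Lemma hess_funE n (m : revHess n) (i : 'I_n) : hess_fun m i = m i.
Proof. by rewrite /hess_fun valK. Qed.

Lemma hess_fun_hessenberg n (m : revHess n) : hessenberg n (hess_fun m).
Proof.
split=> [i ilt|i j ij jn].
  by rewrite -[i]/(val (Ordinal ilt)) hess_funE -ltnS rh_lt.
rewrite -[j]/(val (Ordinal jn)) -[i]/(val (Ordinal (leq_ltn_trans ij jn))).
by rewrite !hess_funE rh_monotone.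
Qed.

Lemma inc_adjacent n (m : revHess n) (x y : nuio m) :
  inc x y = adjacent (hess_fun m) (x : 'I_n) (y : 'I_n).
Proof.
rewrite /inc /Order.comparable /adjacent !hess_funE !le_eqVlt !nuio_ltE /nuio_label.
have := rh_lt m x; have := rh_lt m y.
rewrite -[x == y]/((x : 'I_n) == (y : 'I_n)) -[y == x]/((y : 'I_n) == (x : 'I_n)).
rewrite -!(inj_eq val_inj) /=; lia.
Qed.

Notation toQ := (map_mpoly (intmul (1 : rat))).

Lemma toQ_inj N : injective (toQ : {mpoly int[N]} -> {mpoly rat[N]}).
Proof.
move=> p q pq; apply/mpolyP=> mon; apply: (@intr_inj rat).
by have := congr1 (mcoeff mon) pq; rewrite !mcoeff_map_mpoly.
Qed.

Lemma toQ_X N (i : 'I_N) : toQ ('X_i : {mpoly int[N]}) = 'X_i%R.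
Proof. exact: map_mpolyX. Qed.

Lemma toQ_mesym N k : toQ (mesym N int k) = mesym N rat k.
Proof.
rewrite /mesym rmorph_sum /=; apply: eq_bigr => h _.
by rewrite rmorph_prod /=; apply: eq_bigr => i _; rewrite toQ_X.
Qed.

Lemma toQ_chromatic n N (m : revHess n) :
  toQ (chromatic (@inc _ (nuio m)) N) = chromQ n N (hess_fun m).
Proof.
rewrite /chromatic rmorph_sum /=; apply: eq_big => [k|k _].
  by apply: eq_forallb => u; apply: eq_forallb => v; rewrite inc_adjacent.
by rewrite rmorph_prod /=; apply: eq_bigr => i _; rewrite toQ_X.
Qed.

Lemma chromatic_sym (V : finType) (G : rel V) N : chromatic G N \is symmetric.
Proof.
apply/issymP=> s; rewrite /chromatic rmorph_sum /=.
pose sh (k : {ffun V -> 'I_N}) : {ffun V -> 'I_N} := [ffun v => s (k v)].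
have shK : bijective sh.
  exists (fun k : {ffun V -> 'I_N} => [ffun v => (s^-1)%g (k v)]) => k;
    apply/ffunP=> v; by rewrite !ffunE ?permK ?permKV.
rewrite [RHS](reindex sh) /=; last exact: onW_bij.
apply: eq_big => [k|k _].
  apply: eq_forallb => u; apply: eq_forallb => v; rewrite !ffunE.
  by rewrite (inj_eq perm_inj).
rewrite rmorph_prod /=; apply: eq_bigr => v _.
by rewrite ffunE /msym mmapX mmap1U.
Qed.

Lemma part_bounds n mu : is_partn n mu -> all (fun k => 0 < k <= n) mu && (size mu <= n).
Proof.
case/and3P=> _ pos /eqP <- {n}; elim: mu pos => //= k mu IH /andP[k0 /IH/andP[H1 H2]].
rewrite k0 leq_addr /=; apply/andP; split; last by lia.
by apply: sub_all H1 => i /andP[-> /=]; lia.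
Qed.

Section Partitions.
Variable n : nat.

(** The exponents of e_1, ..., e_n in e_mu. *)
Definition part_mnm (mu : seq nat) : 'X_{1..n} := [multinom count_mem i.+1 mu | i < n].

Lemma prod_part_mnm (R : comNzRingType) (F : nat -> R) mu :
  all (fun k => 0 < k <= n) mu ->
  (\prod_(k <- mu) F k = \prod_(i < n) F i.+1 ^+ part_mnm mu i)%R.
Proof.
elim: mu => [_|k mu IH /= /andP[/andP[k0 kn] /IH IHmu]].
  by rewrite big_nil big1 // => i _; rewrite mnmE.
rewrite big_cons IHmu.
have kn' : k.-1 < n by lia.
rewrite [RHS](eq_bigr (fun i : 'I_n =>
  F i.+1 ^+ (i == Ordinal kn') * F i.+1 ^+ part_mnm mu i)%R); last first.
  move=> i _; rewrite !mnmE /= -exprD; congr (_ ^+ (_ + _))%R.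
  by rewrite -(inj_eq val_inj) /=; lia.
rewrite big_split /=; congr (_ * _)%R.
rewrite (bigD1 (Ordinal kn')) //= eqxx expr1 prednK // big1 ?mulr1 //.
by move=> i /negPf->.
Qed.

Lemma part_mnm_inj mu nu : is_partn n mu -> is_partn n nu ->
  part_mnm mu = part_mnm nu -> mu = nu.
Proof.
move=> pmu pnu /mnmP E.
have/andP[amu _] := part_bounds pmu; have/andP[anu _] := part_bounds pnu.
have /and3P[smu _ _] := pmu; have /and3P[snu _ _] := pnu.
apply: (@sorted_eq _ geq) => //.
- by move=> a b c /= ab bc; exact: leq_trans bc ab.
- by move=> a b; rewrite andbC => /anti_leq.
apply/allP=> v; rewrite mem_cat => vmn /=.
have vb : 0 < v <= n by case/orP: vmn; [exact: (allP amu) | exact: (allP anu)].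
have vn : v.-1 < n by lia.
have /andP[v0 _] := vb.
by have := E (Ordinal vn); rewrite !mnmE /= prednK // => ->.
Qed.

Notation bpart := {bseq n of 'I_n.+1}.

Definition to_bpart (s : seq nat) : bpart := insub_bseq n [seq inord k | k <- s].

Lemma to_bpartK mu : is_partn n mu -> map val (to_bpart mu) = mu.
Proof.
move/part_bounds/andP=> [amu smu].
rewrite /to_bpart /insub_bseq val_insubd size_map smu -map_comp.
apply: map_id_in => k /(allP amu) /andP[_ kn] /=; by rewrite inordK.
Qed.

Lemma map_val_bpart_inj : injective (fun mu : bpart => map val mu).
Proof. by move=> mu nu /(inj_map val_inj) E; apply: val_inj. Qed.

Definition e_sum (R : comNzRingType) N (c : seq nat -> R) : {mpoly R[N]} :=
  (\sum_(mu : bpart | is_partn n (map val mu))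
     c (map val mu) *: \prod_(k <- map val mu) mesym N R k)%R.

Definition e_poly (R : comNzRingType) (c : seq nat -> R) : {mpoly R[n]} :=
  (\sum_(mu : bpart | is_partn n (map val mu))
     c (map val mu) *: 'X_[part_mnm (map val mu)])%R.

Lemma e_poly_comp (R : comNzRingType) c :
  (e_poly c \mPo [tuple mesym n R i.+1 | i < n] = e_sum n c)%R.
Proof.
rewrite /e_poly /e_sum rmorph_sum /=; apply: eq_bigr => mu pmu.
rewrite comp_mpolyZ comp_mpolyX; congr (_ *: _)%R.
have/andP[amu _] := part_bounds pmu.
rewrite (prod_part_mnm _ amu); apply: eq_bigr => i _.
by rewrite tnth_mktuple.
Qed.

Lemma e_poly_coef (R : comNzRingType) c (lam : seq nat) : is_partn n lam ->
  ((e_poly c)@_(part_mnm lam) = c lam :> R)%R.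
Proof.
move=> plam; rewrite /e_poly raddf_sum /= (bigD1 (to_bpart lam)) /=; last first.
  by rewrite to_bpartK.
rewrite to_bpartK // mcoeffZ mcoeffX eqxx mulr1 big1 ?addr0 // => mu /andP[pmu mul].
rewrite mcoeffZ mcoeffX; case: eqP => [/(part_mnm_inj pmu plam) E|]; last by rewrite mulr0.
by case/eqP: mul; apply: map_val_bpart_inj; rewrite E to_bpartK.
Qed.

(** Algebraic independence of e_1, ..., e_n in n variables. *)
Lemma e_sum_inj (R : idomainType) (c d : seq nat -> R) (lam : seq nat) :
  e_sum n c = e_sum n d -> is_partn n lam -> c lam = d lam.
Proof.
move=> E plam; rewrite -(e_poly_coef c plam) -(e_poly_coef d plam).
by congr (mcoeff _ _); apply: msym_fundamental_un; rewrite !e_poly_comp.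
Qed.
End Partitions.

Lemma toQ_e_sum n N (c : seq nat -> int) :
  toQ (e_sum n N c) = e_sum n N (fun mu => (c mu)%:~R%R : rat).
Proof.
rewrite /e_sum rmorph_sum /=; apply: eq_bigr => mu _.
rewrite map_mpolyZ rmorph_prod /=; congr (_ *: _)%R.
by apply: eq_bigr => k _; rewrite toQ_mesym.
Qed.

(** A symmetric polynomial over the integers is an integer polynomial in the e_i,
and over the rationals there is only one such expression. *)
Lemma int_e_sum n (p : {mpoly int[n]}) (c : seq nat -> rat) :
  p \is symmetric -> toQ p = e_sum n n c ->
  exists d : seq nat -> int, forall mu, is_partn n mu -> c mu = (d mu)%:~R%R.
Proof.
move=> /sym_fundamental[t [tE _]] pE.
exists (fun mu => mcoeff (part_mnm n mu) t) => mu pmu.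
rewrite -(e_poly_coef c pmu) -mcoeff_map_mpoly; congr (mcoeff _ _).
have mesymE : [tuple of [seq toQ q | q <- [tuple mesym n int i.+1 | i < n]]]
    = [tuple mesym n rat i.+1 | i < n].
  by apply: eq_from_tnth => i; rewrite tnth_map !tnth_mktuple toQ_mesym.
apply: msym_fundamental_un; rewrite e_poly_comp -pE -tE.
by rewrite map_mpoly_comp ?mesymE //; exact: intr_inj.
Qed.

Lemma geq_trans : transitive geq.
Proof. by move=> a b c /= ab bc; exact: leq_trans bc ab. Qed.

Section Expansion.
Variables (n : nat) (m : revHess n).

Definition word_shape (w : {ffun 'I_n -> 'I_n}) : seq nat :=
  [seq k <- row_lengths w | 0 < k].

Lemma word_shape_partn w : is_partn n (word_shape w).
Proof.
apply/and3P; split.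
- apply: sorted_filter; first exact: geq_trans.
  apply: (homo_sorted (e := leq)); last exact: iota_sorted.
  move=> r s rs; apply: subset_leq_card; apply/subsetP=> c; rewrite !inE.
  exact: leq_ltn_trans.
- by apply/allP=> k; rewrite mem_filter => /andP[].
- rewrite sumnE big_filter (eq_bigl (fun k => k != 0)) => [|k]; last by rewrite lt0n.
  rewrite big_rmcond /=; last by move=> k; rewrite negbK => /eqP.
  rewrite big_map -[X in iota 0 X]subn0 -/(index_iota 0 n) big_mkord.
  rewrite (eq_bigr (fun r : 'I_n => \sum_(c < n | r < height w c) 1)); last first.
    by move=> r _; rewrite sum1_card.
  rewrite (exchange_big_dep predT) //= (eq_bigr (fun c : 'I_n => height w c)); last first.
    by move=> c _; rewrite sum1_card card_ord_lt ?height_le.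
  rewrite (eq_bigr (fun c : 'I_n => \sum_(i < n | w i == c) 1)); last first.
    by move=> c _; rewrite sum1_card.
  by rewrite (exchange_big_dep predT) //= (eq_bigr (fun=> 1)) => [|i _];
    [rewrite sum1_card card_ord | rewrite (big_pred1 (w i)) // => c; rewrite eq_sym].
Qed.

Definition word_coef (mu : seq nat) : rat :=
  ((\sum_(w | word_shape w == mu) word_weight (hess_fun m) w) * (\prod_(k <- mu) k`!%:R))%R.

Lemma chromQ_e_sum N : chromQ n N (hess_fun m) = e_sum n N word_coef.
Proof.
rewrite (chromQ_word_sum N (hess_fun_hessenberg m)) /word_sum.
rewrite (partition_big (fun w => to_bpart n (word_shape w))
  (fun mu : {bseq n of 'I_n.+1} => is_partn n (map val mu))) /=; last first.
  by move=> w _; rewrite to_bpartK word_shape_partn.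
apply: eq_bigr => mu pmu; rewrite /word_coef -scalerA scaler_suml.
apply: eq_big => [w|w /eqP wmu].
  apply/eqP/eqP=> [<-|wmu]; first by rewrite to_bpartK ?word_shape_partn.
  by apply: map_val_bpart_inj; rewrite to_bpartK ?word_shape_partn.
congr (_ *: _)%R; rewrite /word_term -(prod_filter_pos _ (fact_e0 N)).
rewrite -/(word_shape w) -[in LHS](to_bpartK (word_shape_partn w)) wmu.
elim: (map val mu) => [|k s IH]; first by rewrite !big_nil scale1r.
by rewrite !big_cons IH /fact_e -scalerAl -scalerAr scalerA.
Qed.

Lemma is_e_expansionE (c : seq nat -> int) :
  is_e_expansion (@inc _ (nuio m)) c <->
  forall N, chromatic (@inc _ (nuio m)) N = e_sum n N c.
Proof.
rewrite /is_e_expansion.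
move: #|_| (card_ord n : #|(nuio m : finPOrderType _)| = n) => k kn.
by subst k.
Qed.

(** Integrality is obtained in n variables; the formula itself holds in any
number of them. *)
Lemma inc_e_expansion :
  exists c : seq nat -> int, is_e_expansion (@inc _ (nuio m)) c.
Proof.
have [||d dE] := @int_e_sum n (chromatic (@inc _ (nuio m)) n) word_coef.
- exact: chromatic_sym.
- by rewrite toQ_chromatic chromQ_e_sum.
exists d; apply/is_e_expansionE => N; apply: toQ_inj.
rewrite toQ_chromatic chromQ_e_sum toQ_e_sum.
by apply: eq_bigr => mu pmu; rewrite dE.
Qed.

Lemma chrom_coefE lam : is_partn n lam ->
  word_coef lam = (chrom_coef (nuio m) lam)%:~R%R.
Proof.
move=> plam.
have /is_e_expansionE/(_ n) E : is_e_expansion (@inc _ (nuio m)) (chrom_coef (nuio m)).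
  exact: ClassicalEpsilon.epsilon_spec inc_e_expansion.
have := congr1 (fun p => toQ p) E; rewrite toQ_chromatic chromQ_e_sum toQ_e_sum.
by move/e_sum_inj/(_ plam).
Qed.

Lemma chrom_coef_word lam : is_partn n lam -> (0 < chrom_coef (nuio m) lam)%R ->
  exists2 w, word_shape w = lam & word_weight (hess_fun m) w != 0%R.
Proof.
move=> plam; rewrite -(ltr0z rat) -chrom_coefE // => clam.
have : word_coef lam != 0%R by rewrite gt_eqF.
rewrite /word_coef mulf_eq0 negb_or => /andP[+ _].
have [/existsP[w /andP[/eqP wl Ww]] _|] :=
  boolP [exists w, (word_shape w == lam) && (word_weight (hess_fun m) w != 0%R)].
  by exists w.
move/existsPn=> H; rewrite big1 ?eqxx // => w wl.
by have := H w; rewrite wl negbK => /eqP.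
Qed.
End Expansion.

(** * Adding a cell at the foot of a column *)

Section Columns.
Variable A : Type.
Implicit Types (T : seq (seq A)) (row : seq A).

Lemma size_column T j : size (column T j) = count (fun k => j < k) (shape T).
Proof.
by rewrite size_pmap count_map; apply: eq_count => row /=; rewrite onthTE.
Qed.

Lemma column_cat T1 T2 j : column (T1 ++ T2) j = column T1 j ++ column T2 j.
Proof. exact: pmap_cat. Qed.

Lemma column_cons row T j : column (row :: T) j = seq_of_opt (onth row j) ++ column T j.
Proof. by rewrite /column /=; case: onth. Qed.

Lemma size_row_gt T j t : sorted geq (shape T) ->
  (j < size (nth [::] T t)) = (t < size (column T j)).
Proof.
rewrite size_column; elim: T t => [|row T IH] t srt /=; first by rewrite nth_nil.
have small : size row <= j -> count (fun k => j < k) (shape T) = 0.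
  move=> rj; rewrite (@eq_in_count _ _ pred0) ?count_pred0 // => k.
  by move/(allP (order_path_min geq_trans srt)) => /= kr; lia.
case: t => [|t] /=; last rewrite IH ?(path_sorted srt) //.
  by have [//|/small->] := ltnP j (size row).
by have [//|/small->] := ltnP j (size row).
Qed.

Lemma nth_column x0 T j t : sorted geq (shape T) -> t < size (column T j) ->
  nth x0 (column T j) t = nth x0 (nth [::] T t) j.
Proof.
move=> srt; rewrite -size_row_gt //.
elim: T t srt => [|row T IH] t srt; first by rewrite nth_nil.
case: t => [|t] jt; rewrite column_cons.
  by rewrite -[RHS]odflt_onth; case: (onth row j) (onthTE row j) => //=; rewrite jt.
have srt' := path_sorted srt.
have jr : j < size row.
  rewrite (size_row_gt j 0 srt) column_cons size_cat.
  by move: jt; rewrite /= size_row_gt //; lia.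
case: (onth row j) (onthTE row j) => [a _|]; last by rewrite jr.
by rewrite /= IH.
Qed.

Lemma column_nil_row j : column [:: ([::] : seq A)] j = [::].
Proof. by rewrite column_cons onth0n. Qed.
End Columns.

Definition addable (T : seq (seq nat)) (j : nat) : Prop :=
  j = 0 \/ size (column T j) < size (column T j.-1).

Section AddBottom.
Variables (T : seq (seq nat)) (j x : nat).
Hypotheses (srt : sorted geq (shape T)) (addT : addable T j).
Let i := size (column T j).
Let row := nth [::] T i.

Lemma addable_size : size row = j.
Proof.
apply/eqP; rewrite eqn_leq; apply/andP; split.
  by rewrite leqNgt size_row_gt // ltnn.
case: addT => [->//|]; rewrite -/i -size_row_gt //; case: (j) => //.
Qed.

Lemma i_le_size : i <= size T.
Proof. by rewrite /i size_column -(size_map size T) count_size. Qed.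

Lemma add_bottomE :
  add_bottom T j x = take i T ++ rcons row x :: drop i.+1 T.
Proof.
rewrite /add_bottom -/i -/row.
have -> : set_nth 0 row j x = rcons row x.
  by rewrite set_nthE addable_size ltnn subnn /= cats1.
rewrite set_nthE; case: ltnP => // Ti.
have iT : i = size T by apply/eqP; rewrite eqn_leq i_le_size.
by rewrite iT subnn take_size drop_oversize.
Qed.

(** Row i is absent when the cell opens a new row, and then counts as empty. *)
Lemma splitT (f : seq (seq nat) -> seq nat) :
  (forall T1 T2, f (T1 ++ T2) = f T1 ++ f T2) -> f [:: [::]] = [::] ->
  f T = f (take i T) ++ f [:: row] ++ f (drop i.+1 T).
Proof.
move=> fcat fnil; have [iT|Ti] := ltnP i (size T).
  by rewrite -{1}(cat_take_drop i T) (drop_nth [::] iT) -cat1s !fcat.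
rewrite take_oversize // drop_oversize; last by lia.
have f0 : f [::] = [::].
  by apply/size0nil; have := congr1 size (fcat [::] [::]); rewrite size_cat /=; lia.
by rewrite /row nth_default // fnil f0 !cats0.
Qed.

Lemma column_add_bottom j' :
  column (add_bottom T j x) j' = if j' == j then rcons (column T j) x else column T j'.
Proof.
have colT j1 : column T j1
    = column (take i T) j1 ++ column [:: row] j1 ++ column (drop i.+1 T) j1.
  apply: (splitT (f := fun T1 => column T1 j1)); last exact: column_nil_row.
  by move=> T1 T2; exact: column_cat.
rewrite add_bottomE column_cat -cat1s column_cat.
have [->|jj'] := eqVneq j' j; last first.
  rewrite colT; congr (_ ++ (_ ++ _)); rewrite !column_cons -cats1 onth_cat addable_size.
  case: ltnP => // jlt; rewrite (onth_default (s := row)) ?addable_size //.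
  by rewrite onth_default //=; lia.
rewrite colT.
have dropN : column (drop i.+1 T) j = [::].
  have it : i <= size (column (take i T) j).
    have [->//|i0] := posnP i.
    have st : sorted geq (shape (take i T)) by rewrite /shape map_take; exact: take_sorted.
    have ii : i.-1 < i by lia.
    have := size_row_gt j i.-1 st; rewrite nth_take // size_row_gt //; rewrite -/i ii => /esym.
    by rewrite prednK.
  have := congr1 size (colT j).
  by rewrite -/i !size_cat => E; apply/size0nil; lia.
rewrite dropN !column_cons /= -cats1 onth_cat addable_size ltnn subnn /=.
by rewrite onth_default ?addable_size //= cats0 cats1.
Qed.

Lemma shape_add_bottom :
  shape (add_bottom T j x) = shape (take i T) ++ j.+1 :: shape (drop i.+1 T).
Proof. by rewrite add_bottomE /shape map_cat /= size_rcons addable_size. Qed.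

Lemma sorted_add_bottom : sorted geq (shape (add_bottom T j x)).
Proof.
rewrite shape_add_bottom sorted_pairwise; last exact: geq_trans.
have := srt; rewrite sorted_pairwise; last exact: geq_trans.
rewrite -{1}(cat_take_drop i T) /shape map_cat !pairwise_cat => /and3P[tk1 tk2 dr].
have hi k : k \in shape (take i T) -> j < k.
  case/(nthP 0) => t; rewrite size_map => ti <-.
  have ti' : t < i by move: ti; rewrite size_take; case: ifP; lia.
  by rewrite (nth_map [::]) // nth_take // size_row_gt.
have lo k : k \in shape (drop i.+1 T) -> k <= j.
  case/(nthP 0) => t; rewrite size_map => ti <-.
  rewrite (nth_map [::]) // nth_drop leqNgt size_row_gt // -/i; lia.
apply/and3P; split => //.
- apply/allrelP => a b ain; rewrite inE => /predU1P[->|bin]; first exact: hi.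
  exact: ltnW (leq_ltn_trans (lo b bin) (hi a ain)).
- rewrite /=; apply/andP; split; first by apply/allP=> k /lo /= kj; exact: leqW.
  move: dr; have [iT|Ti] := ltnP i (size T); last by rewrite !drop_oversize //; lia.
  by rewrite (drop_nth [::] iT) /= => /andP[].
Qed.

Lemma perm_add_bottom : perm_eq (flatten (add_bottom T j x)) (x :: flatten T).
Proof.
rewrite add_bottomE (splitT (@flatten_cat _) erefl) flatten_cat /= cats0.
by rewrite cat_rcons catA -[x :: flatten _]cat1s perm_catCA -catA.
Qed.

Lemma mem_add_bottom r : r \in add_bottom T j x -> r = rcons row x \/ r \in T.
Proof.
rewrite add_bottomE mem_cat inE => /or3P[/mem_take|/eqP->|/mem_drop]; by [left|right].
Qed.

Lemma mem_row : row \in T \/ row = [::].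
Proof.
have [iT|Ti] := ltnP i (size T); first by left; exact: mem_nth.
by right; rewrite /row nth_default.
Qed.
End AddBottom.

(** * Anchored tableaux are strong *)

Lemma mem_column (A : eqType) (T : seq (seq A)) j x : x \in column T j -> x \in flatten T.
Proof.
rewrite mem_pmap => /mapP[row rT /esym E]; apply/flattenP; exists row => //.
by apply/onthP; exists j.
Qed.

Section SYT.
Variables (n : nat) (T : seq (seq nat)).
Hypothesis sytT : is_SYT n T.

Lemma SYT_sorted_shape : sorted geq (shape T).
Proof. by case/and4P: sytT => /and3P[]. Qed.

Lemma SYT_shape_gt0 : all (leq 1) (shape T).
Proof. by case/and4P: sytT => /and3P[]. Qed.

Lemma SYT_perm : perm_eq (flatten T) (iota 1 n).
Proof. by case/and4P: sytT. Qed.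

Lemma SYT_row row : row \in T -> sorted ltn row.
Proof. by case/and4P: sytT => _ _ /allP rT _ /rT. Qed.

Lemma SYT_column_nil j : n <= j -> column T j = [::].
Proof.
case/and4P: sytT => /part_bounds/andP[amu _] _ _ _ nj.
apply: size0nil; rewrite size_column (@eq_in_count _ _ pred0) ?count_pred0 // => k.
by move/(allP amu) => /=; lia.
Qed.

Lemma SYT_column j : sorted ltn (column T j).
Proof.
have [jn|nj] := ltnP j n; last by rewrite SYT_column_nil.
case/and4P: sytT => _ _ _ /allP; apply; by rewrite mem_iota.
Qed.

Lemma SYT_entry j x : x \in column T j -> 0 < x <= n.
Proof. by move/mem_column; rewrite (perm_mem SYT_perm) mem_iota; lia. Qed.

(** If column j were as long as its left neighbour, the last entry of the latter
would exceed r, and would be less than the entry of column j on its right. *)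
Lemma SYT_addable j r :
  (j = 0 \/ exists2 y, y \in column T j.-1 & r < y) ->
  (forall x, x \in column T j -> x <= r) -> addable T j.
Proof.
move=> [->|[y yT ry]] Tr; [by left | right].
have srt := SYT_sorted_shape.
case: j => [|j] /= in yT Tr *; first by have := Tr y yT; lia.
rewrite ltnNge; apply/negP=> le.
have [t tlt yE] := nthP 0 yT; set h := size (column T j) in tlt le.
pose a := nth 0 (column T j) h.-1; pose b := nth 0 (column T j.+1) h.-1.
have h1 : h.-1 < h by lia.
have ya : y <= a.
  rewrite -yE /a; have [->//|th] : t = h.-1 \/ t < h.-1 by lia.
  apply: ltnW; apply: (sorted_ltn_nth ltn_trans) => //; exact: SYT_column.
have br : b <= r by apply: Tr; rewrite mem_nth //; apply: leq_trans h1 le.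
have h2 : h.-1 < size (column T j.+1) by exact: leq_trans h1 le.
suff : a < b by lia.
rewrite /a /b !nth_column //.
have rj : j.+1 < size (nth [::] T h.-1) by rewrite size_row_gt.
have srow : sorted ltn (nth [::] T h.-1).
  apply: SYT_row; apply: mem_nth; rewrite ltnNge; apply/negP=> /(nth_default [::]) E.
  by rewrite E in rj.
by apply: (sorted_ltn_nth ltn_trans 0 srow); rewrite ?inE // ltnW.
Qed.

Lemma SYT_add_bottom j : addable T j -> is_SYT n.+1 (add_bottom T j n.+1).
Proof.
move=> aT; have srt := SYT_sorted_shape.
have lt_last s : (forall x, x \in s -> x \in flatten T) -> sorted ltn s ->
    sorted ltn (rcons s n.+1).
  case: s => //= a s sT path_s; rewrite rcons_path path_s /= ltnS.
  have := sT (last a s); rewrite (perm_mem SYT_perm) mem_iota add1n ltnS.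
  by move=> /(_ (mem_last a s))/andP[].
apply/and4P; split.
- apply/and3P; split; first exact: sorted_add_bottom.
    rewrite shape_add_bottom // /shape map_take map_drop all_cat /=.
    apply/andP; split; apply/allP=> k; last move/mem_drop; try move/mem_take;
      exact: (allP SYT_shape_gt0).
  have := perm_size (perm_add_bottom n.+1 srt aT).
  rewrite size_flatten /= (perm_size SYT_perm) size_iota => ->; exact: eqxx.
- rewrite -addn1 iotaD addn1 add1n cats1.
  apply: (perm_trans (perm_add_bottom _ srt aT)).
  by rewrite perm_sym perm_rcons perm_cons perm_sym SYT_perm.
- apply/allP=> row /(mem_add_bottom srt aT) [->|]; last exact: SYT_row.
  have [rT|->//] := mem_row T j.
  apply: lt_last; last exact: SYT_row.
  by move=> x xr; apply/flattenP; exists (nth [::] T (size (column T j))).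
- apply/allP=> j' _; rewrite column_add_bottom //.
  case: ifP => _; last exact: SYT_column.
  by apply: lt_last; [exact: mem_column | exact: SYT_column].
Qed.
End SYT.

(** The entries of T start from 1, the arguments of mu from 0. *)
Definition anchored (mu : nat -> nat) (T : seq (seq nat)) : Prop :=
  (forall j x, x \in column T j.+1 ->
     exists2 y, y \in column T j & mu x.-1 < y < x) /\
  (forall j x y, x \in column T j -> y \in column T j -> y < x -> y <= mu x.-1).

Lemma anchored_add_bottom mu n T j : is_SYT n T -> anchored mu T ->
  (j = 0 \/ exists2 y, y \in column T j.-1 & mu n < y) ->
  (forall x, x \in column T j -> x <= mu n) ->
  anchored mu (add_bottom T j n.+1).
Proof.
move=> syt [g1 g2] hj hlow; have aT := SYT_addable syt hj hlow.
have cE := column_add_bottom n.+1 (SYT_sorted_shape syt) aT.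
have sub j' y : y \in column T j' -> y \in column (add_bottom T j n.+1) j'.
  by rewrite cE; case: ifP => // /eqP-> yT; rewrite mem_rcons inE yT orbT.
have memE j' x : x \in column (add_bottom T j n.+1) j' ->
    x \in column T j' \/ j' = j /\ x = n.+1.
  rewrite cE; case: ifP => [/eqP->|_]; last by left.
  by rewrite mem_rcons inE => /predU1P[->|xT]; [right | left].
split=> [j' x /memE [|[jE ->]]|j' x y /memE [xT|[-> ->]] /memE [yT|[_ ->]]].
- by move/g1 => [y yT yx]; exists y => //; exact: sub.
- case: hj => [|[y]]; first by lia.
  have -> : j.-1 = j' by lia.
  move=> yT my; exists y; first exact: sub.
  by rewrite my ltnS; case/andP: (SYT_entry syt yT).
- exact: g2 xT yT.
- by case/andP: (SYT_entry syt xT); lia.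
- by move=> _; exact: hlow.
- by rewrite ltnn.
Qed.

Section Strong.
Variables (n : nat) (m : revHess n).

Lemma labels_exist (s : seq nat) : all (fun x => 0 < x <= n) s ->
  exists u : seq (nuio m), map (@nuio_label n m) u = s.
Proof.
elim: s => [_|x s IH /= /andP[/andP[x0 xn] /IH[u uE]]]; first by exists [::].
have xn' : x.-1 < n by lia.
exists ((Ordinal xn' : nuio m) :: u); rewrite /= uE; congr (_ :: _).
by rewrite /nuio_label /= prednK.
Qed.

Lemma tab_labels_exist (T : seq (seq nat)) :
  all (fun x => 0 < x <= n) (flatten T) -> exists U : seq (seq (nuio m)), tab_labels U = T.
Proof.
elim: T => [_|row T IH]; first by exists [::].
rewrite /= all_cat => /andP[/labels_exist[u uE] /IH[U UE]].
by exists (u :: U); rewrite /= /tab_labels /= uE -[in RHS]UE.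
Qed.

Lemma nuio_label_inj : injective (@nuio_label n m).
Proof. by move=> x y [] /val_inj. Qed.

Lemma nuio_lt_hess_fun (x y : nuio m) :
  (x < y)%O = (nuio_label x <= hess_fun m (nuio_label y).-1).
Proof. by rewrite nuio_ltE /nuio_label /= hess_funE. Qed.

Lemma column_labels (U : seq (seq (nuio m))) j :
  column (tab_labels U) j = map (@nuio_label n m) (column U j).
Proof.
elim: U => // row U IH.
rewrite -[tab_labels _]/(map (@nuio_label n m) row :: tab_labels U) !column_cons.
by rewrite map_cat -IH onth_map; case: onth.
Qed.

(** The map f picks for an entry of the right column an
incomparable smaller entry of the left one; it preserves ladders and is
injective. *)
Lemma anchored_strong T : is_SYT n T -> anchored (hess_fun m) T ->
  exists2 U : seq (seq (nuio m)), strongST (shape T) U & tab_labels U = T.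
Proof.
move=> syt [g1 g2].
have [|U UE] := @tab_labels_exist T.
  by rewrite (perm_all _ (SYT_perm syt)); apply/allP=> x; rewrite mem_iota; lia.
have cE j : column T j = map (@nuio_label n m) (column U j) by rewrite -UE column_labels.
have memU j (x : nuio m) : (nuio_label x \in column T j) = (x \in column U j).
  by rewrite cE mem_map //; exact: nuio_label_inj.
exists U => //; split.
- split.
  + by rewrite -UE /shape /tab_labels -map_comp; apply: eq_map => row /=; rewrite size_map.
  + move=> j; have := SYT_column syt j; rewrite cE sorted_map.
    apply: (sub_in_sorted (P := mem (column U j))) => [x y xU yU /= xy|]; last exact/allP.
    by rewrite nuio_lt_hess_fun; apply: (g2 j) xy; rewrite memU.
  + move=> row rU.
    have : sorted ltn (map (@nuio_label n m) row).
      by apply: (SYT_row syt); rewrite -UE /tab_labels map_f.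
    rewrite sorted_map; apply: sub_sorted => x y /= xy.
    by apply/negP=> /nuio_lt_ltn; lia.
- move=> j L /imsetP[x _ ->]; rewrite /right_unbalanced -leqNgt.
  set e := (X in connect X).
  have [f fP] : exists f : nuio m -> nuio m, forall d, d \in column U j.+1 ->
      f d \in column U j /\
      hess_fun m (nuio_label d).-1 < nuio_label (f d) < nuio_label d.
    pose R (d c : nuio m) := (c \in column U j) &&
      (hess_fun m (nuio_label d).-1 < nuio_label c < nuio_label d).
    exists (fun d => odflt d [pick c | R d c]) => d.
    rewrite -(memU j.+1) => dT; have [y yT yd] := g1 _ _ dT; case: pickP => [c /andP[]//|].
    have := yT; rewrite cE => /mapP[c cU yE] /(_ c).
    by rewrite /R cU -yE yd.
  have finj : {in [set y in [set y | connect e x y] | y \in column U j.+1] &, injective f}.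
    suff H d d' : d \in column U j.+1 -> d' \in column U j.+1 -> f d = f d' ->
        ~~ (nuio_label d < nuio_label d').
      move=> d d'; rewrite !inE => /andP[_ dU] /andP[_ dU'] E; apply: nuio_label_inj.
      by have := H _ _ dU dU' E; have := H _ _ dU' dU (esym E); lia.
    move=> dU dU' E; apply/negP=> dd'.
    have [_ /andP[_ fd]] := fP _ dU; have [_ /andP[fd' _]] := fP _ dU'.
    have := g2 j.+1 _ _ _ _ dd'; rewrite !memU => /(_ dU' dU).
    by move: fd fd'; rewrite E; lia.
  rewrite -(card_in_imset finj); apply: subset_leq_card.
  apply/subsetP=> _ /imsetP[d + ->]; rewrite !inE => /andP[xd dU].
  have [fU /andP[fd1 fd2]] := fP _ dU; rewrite fU andbT.
  apply: connect_trans xd (connect1 _).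
  rewrite /e /= !mem_cat dU fU orbT /= inc_adjacent /adjacent.
  by move: fd1 fd2; rewrite /nuio_label /=; lia.
- move=> x.
  have -> : count_mem x (flatten U) = count_mem (nuio_label x) (flatten T).
    rewrite -UE /tab_labels -map_flatten count_map; apply: eq_count => y /=.
    by rewrite (inj_eq nuio_label_inj).
  rewrite (seq.permP (SYT_perm syt)) count_uniq_mem ?iota_uniq // mem_iota.
  by rewrite /nuio_label; have := ltn_ord (x : 'I_n); lia.
Qed.
End Strong.

(** * Hikita's process builds anchored tableaux *)

(** The trailing 0 makes every block of zeros nonempty. *)
Lemma blocks_end (s : bitseq) (k : nat) : k < size (blocks (rcons s false)) ->
  let B := blocks (rcons s false) in
  let c := \sum_(0 <= i < k) (nth (0, 0) B i).2 + \sum_(0 <= i < k.+1) (nth (0, 0) B i).1 in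
  [/\ c < size (rcons s false), nth true (rcons s false) c = false
    & c = 0 \/ nth false (rcons s false) c.-1 = true].
Proof.
set bs := rcons s false; move=> kB B c.
have /andP[b_gt0 _] := blocks_gt0 bs.
have /andP[_ a_gt0] := blocks_gt0 s.
have ak : 0 < (nth (0, 0) B k).2 by apply: (allP a_gt0); rewrite mem_nth.
pose F (ba : nat * nat) := nseq ba.1 true ++ nseq ba.2 false.
pose pre := flatten (map F (take k B)).
have preE : size pre = \sum_(0 <= i < k) ((nth (0, 0) B i).2 + (nth (0, 0) B i).1).
  have : k <= size B by exact: ltnW.
  rewrite /pre; elim: (k) => [|i IH] iB; first by rewrite take0 big_geq.
  rewrite (take_nth (0, 0)) // map_rcons flatten_rcons size_cat IH 1?ltnW //.
  by rewrite big_nat_recr //= size_cat !size_nseq; lia.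
have bsE : bs = pre ++ nseq (nth (0, 0) B k).1 true ++
    nseq (nth (0, 0) B k).2 false ++ flatten (map F (drop k.+1 B)).
  rewrite -{1}(blocksK bs) -/B -{1}(cat_take_drop k B) (drop_nth (0, 0)) //.
  by rewrite map_cat flatten_cat /= /F -catA.
have cE : c = size pre + (nth (0, 0) B k).1.
  by rewrite preE /c big_nat_recr //= big_split /= addnA.
split.
- by rewrite bsE !size_cat !size_nseq; lia.
- rewrite bsE nth_cat cE ltnNge leq_addr /= addKn nth_cat size_nseq ltnn subnn.
  by rewrite nth_cat size_nseq ak nth_nseq ak.
have [b0|b_pos] := posnP (nth (0, 0) B k).1; last first.
  right; rewrite bsE nth_cat cE ifN; last by rewrite -leqNgt; lia.
  rewrite nth_cat size_nseq ifT; last by lia.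
  by rewrite nth_nseq ifT //; lia.
left; case: k kB @c ak @pre preE bsE cE b0 => [|k'] kB c ak pre preE bsE cE b0.
  by rewrite cE preE big_geq // b0.
have : 0 < (nth (0, 0) B k'.+1).1.
  rewrite -nth_behead; apply: (allP b_gt0); rewrite mem_nth // size_behead.
  by rewrite -subn1 ltn_subRL add1n.
by rewrite b0.
Qed.

Lemma delta_rcons n r T : is_SYT n T ->
  delta n r T = rcons (mkseq (fun i => r < \max_(x <- column T i) x) n) false.
Proof.
move=> syt; rewrite /delta mkseqS.
by rewrite (SYT_column_nil syt (leqnn n)) big_nil.
Qed.

(** The new column starts a block of zeros of delta: it has no entry above r,
and the column before it belongs to a block of ones. *)
Lemma hcol_active n r T (k : 'I_(hl n r T).+1) : is_SYT n T ->
  let j := hcol n r T k in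
  (j = 0 \/ exists2 y, y \in column T j.-1 & r < y) /\
  (forall x, x \in column T j -> x <= r).
Proof.
move=> syt j.
have dE := delta_rcons r syt.
have kB : k < size (blocks (delta n r T)).
  have B0 : 0 < size (blocks (delta n r T)).
    rewrite lt0n size_eq0; apply/eqP=> E.
    by have := congr1 size (blocksK (delta n r T)); rewrite E dE size_rcons.
  by have := ltn_ord k; rewrite {2}/hl; lia.
have [] := @blocks_end (mkseq (fun i => r < \max_(x <- column T i) x) n) k.
  by rewrite -dE.
rewrite -dE; set c := (X in X < _) => cn c0 c1.
have jc : j = c by rewrite /j /hcol /c big_add1.
rewrite /delta size_mkseq in cn; rewrite jc.
have nthE x0 i : i < n.+1 -> nth x0 (delta n r T) i = (r < \max_(x <- column T i) x).
  by move=> ilt; rewrite nth_mkseq.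
rewrite nthE // in c0; split; last first.
  move=> x xc; rewrite leqNgt; apply/negP=> rx; move/negP: c0; apply.
  by apply: leq_trans rx _; exact: (@leq_bigmax_seq _ _ xpredT (fun x => x)).
case: c1 => [|c1]; [by left | right].
have cn' : c.-1 < n.+1 by lia.
rewrite nthE // in c1.
case: (boolP (has (fun y => r < y) (column T c.-1))) => [/hasP[y]|/hasPn H]; first by exists y.
suff : \max_(x <- column T c.-1) x <= r by rewrite leqNgt c1.
by apply/bigmax_leqP_seq => x xc _; rewrite leqNgt H.
Qed.

Lemma prob_anchored n (m : revHess n) T : is_SYT n T -> prob m T != 0%R ->
  anchored (hess_fun m) T.
Proof.
elim: n m T => [|n IH] m T syt.
  move=> _; have noC j x : x \notin column T j.
    by apply/negP=> /(SYT_entry syt); lia.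
  by split=> [j x xT|j x y xT]; rewrite (negPf (noC _ _)) in xT.
rewrite /=; set S := tab_restr n T; set r := m ord_max.
case: pickP => [k /andP[sytS /eqP kT]|_]; last by rewrite eqxx.
rewrite mulf_eq0 negb_or => /andP[_ /(IH _ _ sytS) gS].
have [hj hlow] := hcol_active k sytS.
rewrite -kT /hik_add.
have rE : hess_fun m n = r by rewrite -[n]/(val (@ord_max n)) hess_funE.
apply: anchored_add_bottom => //; rewrite ?rE //.
have mE i : 0 < i <= n -> hess_fun (rh_restr m) i.-1 = hess_fun m i.-1.
  move=> i_n; have ilt : i.-1 < n by lia.
  rewrite -[i.-1]/(val (Ordinal ilt)) hess_funE /=.
  exact/esym/(hess_funE m (widen_ord (leqnSn n) (Ordinal ilt))).
case: gS => g1 g2; split=> [j x xT|j x y xT yT].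
  by have := g1 j x xT; rewrite mE //; exact: SYT_entry xT.
by have := g2 j x y xT yT; rewrite mE //; exact: SYT_entry xT.
Qed.

Section WordTableau.
Variables (n : nat) (m : nat -> nat) (w : {ffun 'I_n -> 'I_n}).
Hypothesis Ww : word_weight m w != 0%R.

Let wn (i : nat) : nat := oapp (fun o : 'I_n => w o : nat) 0 (insub i).

Let wnE (i : 'I_n) : wn i = w i.
Proof. by rewrite /wn valK. Qed.

Fixpoint word_tab (k : nat) : seq (seq nat) :=
  if k is k'.+1 then add_bottom (word_tab k') (wn k') k'.+1 else [::].

Lemma word_tabP k : k <= n ->
  [/\ is_SYT k (word_tab k), anchored m (word_tab k)
    & forall j, column (word_tab k) j = [seq i.+1 | i <- iota 0 k & wn i == j]].
Proof.
elim: k => [_|k IH kn]; first by split.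
have [syt g cE] := IH (ltnW kn).
pose o := Ordinal kn.
have : insert_weight (window m o) w (w o) != 0%R.
  by move: Ww; rewrite /word_weight (bigD1 o) //= mulf_eq0 negb_or => /andP[].
rewrite /insert_weight mulf_eq0 negb_or pnatr_eq0 eqb0 negbK => /andP[po co].
have wk : wn k = w o by rewrite -(wnE o).
have memC j i : i < n -> (i.+1 \in column (word_tab k) j) = (i < k) && (wn i == j).
  by move=> _; rewrite cE (mem_map succn_inj) mem_filter mem_iota andbC.
have hj : wn k = 0 \/ exists2 y, y \in column (word_tab k) (wn k).-1 & m k < y.
  case/orP: po => [/eqP w0|/existsP[j /andP[/andP[mj jk] /eqP wj]]].
    by left; rewrite wk w0.
  right; exists j.+1; last by [].
  by rewrite memC // jk wnE wk -wj /=.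
have hlow x : x \in column (word_tab k) (wn k) -> x <= m k.
  move=> xT; have /andP[x0 xk] := SYT_entry syt xT.
  have xn : x.-1 < n by lia.
  have := memC (wn k) x.-1 xn; rewrite prednK // xT => /esym/andP[xk' /eqP wx].
  rewrite leqNgt; apply/negP=> mx; move/eqP: co; apply.
  apply: (@insert_value_eq0 _ _ (Ordinal xn)); first by rewrite /window /=; lia.
  by rewrite -wnE /= wx wk.
have aT := SYT_addable syt hj hlow.
rewrite -[word_tab k.+1]/(add_bottom (word_tab k) (wn k) k.+1); split.
- exact: SYT_add_bottom.
- exact: anchored_add_bottom.
- move=> j; rewrite column_add_bottom ?(SYT_sorted_shape syt) // !cE.
  rewrite -[in iota 0 k.+1]addn1 iotaD add0n filter_cat map_cat /= eq_sym.
  by case: eqP => [->|_]; rewrite ?cats1 ?cats0.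
Qed.

(** Both sides are partitions whose conjugate is the list of column heights. *)
Lemma shape_word_tab : shape (word_tab n) = word_shape w.
Proof.
have [syt _ cE] := word_tabP (leqnn n).
have hE c : height w c = count (fun k => c < k) (shape (word_tab n)).
  rewrite -size_column cE size_map size_filter /height -sum1_card -sum1_count.
  rewrite -[X in iota 0 X]subn0 -/(index_iota 0 n) big_mkord.
  by apply: eq_bigl => i; rewrite inE wnE.
have /and3P[srtw posw _] := word_shape_partn w.
apply: (@sorted_eq _ geq) => //.
- exact: geq_trans.
- by move=> a b; rewrite andbC => /anti_leq.
- exact: SYT_sorted_shape syt.
rewrite -(all_filterP (SYT_shape_gt0 syt)).
apply: count_gt_inj => c; rewrite count_row_lengths ?hE // => a b ab.
by rewrite !hE; apply: sub_count => k /=; lia.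
Qed.
End WordTableau.

Theorem theorem1p6 (n : nat) (m : revHess n) (lam : seq nat)
    (hlam : is_partn n lam) :
  (forall T : seq (seq nat), HikSYT m lam T ->
     exists2 U : seq (seq (nuio m)), strongST lam U & tab_labels U = T)
  /\ ((0 < chrom_coef (nuio m) lam)%R ->
      exists U : seq (seq (nuio m)), strongST lam U).
Proof.
split=> [T [sytT <- probT]|clam]; first exact: anchored_strong (prob_anchored sytT probT).
have [w wl Ww] := chrom_coef_word hlam clam.
have [syt g _] := word_tabP Ww (leqnn n).
have [U sU _] := anchored_strong syt g.
by exists U; rewrite -wl -(shape_word_tab Ww).
Qed.
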